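(* Assume that there exist positive constants $M_k$ such that $$\|d(X_1,X_1')\|_\infty\le M_1\quad\text{and}\quad\big\|d\big(F(X_{k-1},\varepsilon_k),F(X_{k-1},\varepsilon_k')\big)\big\|_\infty\le M_k\ \text{ for }k\in[2,n].$$ Let $M^2(n,\rho)=\sum_{k=1}^n(K_{n-k}(\rho)M_k)^2$ and $D(n,\rho)=\sum_{k=1}^nK_{n-k}(\rho)M_k$. Then, for any $t\ge0$, $$\mathbb E[e^{\pm tS_n}]\le\exp\left(\frac{D^2(n,\rho)}{M^2(n,\rho)}\,\ell\Big(\frac{M^2(n,\rho)\,t}{D(n,\rho)}\Big)\right),$$ and, for any $x\in[0,D(n,\rho)]$, $$\mathbb P(\pm S_n>x)\le\exp\left(-\frac{D^2(n,\rho)}{M^2(n,\rho)}\,\ell^*\Big(\frac{x}{D(n,\rho)}\Big)\right).$$ Consequently, for any $x\in[0,D(n,\rho)]$, $$\mathbb P(\pm S_n>x)\le\left(\frac{D(n,\rho)-x}{D(n,\rho)}\right)^{\frac{2D(n,\rho)x-x^2}{M^2(n,\rho)}}.$$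
   Context: $(\mathcal X,d)$ is a complete separable metric space and $\mathcal Y$ a complete separable metric space; $(\varepsilon_i)_{i\ge1}$ is a sequence of iid $\mathcal Y$-valued random variables; $X_1$ is an $\mathcal X$-valued random variable independent of $(\varepsilon_i)_{i\ge2}$. The Markov chain is $X_n=F(X_{n-1},\varepsilon_n)$ for $n\ge2$, where $F:\mathcal X\times\mathcal Y\to\mathcal X$ is measurable and satisfies, for some $\rho\in[0,1)$, $\mathbb E[d(F(x,\varepsilon_1),F(x',\varepsilon_1))]\le\rho\,d(x,x')$ for all $x,x'\in\mathcal X$. $(X_1',(\varepsilon_i')_{i\ge2})$ is an independent copy of $(X_1,(\varepsilon_i)_{i\ge2})$. Fix $n\ge1$ and $f:\mathcal X^n\to\mathbb R$ with $|f(x_1,\ldots,x_n)-f(x_1',\ldots,x_n')|\le d(x_1,x_1')+\cdots+d(x_n,x_n')$, and let $S_n=f(X_1,\ldots,X_n)-\mathbb E[f(X_1,\ldots,X_n)]$. For $k\in\mathbb N$, $K_k(\rho)=1+\rho+\cdots+\rho^k$. Let $$\ell(t)=(t-\ln t-1)+t(e^t-1)^{-1}+\ln(1-e^{-t})\quad(t>0),$$ extended by continuity by $\ell(0)=0$, and let $\ell^*(x)=\sup_{t>0}(xt-\ell(t))\in[0,+\infty]$ for $x\ge0$ (with $e^{-\infty}=0$). Statements with $\pm$ hold for each of the two signs. *)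

(* Defs.v *)
From HB Require Import structures.
From mathcomp Require Import all_boot all_order all_algebra.
From mathcomp Require Import all_classical all_reals all_analysis.

Set Implicit Arguments.
Unset Strict Implicit.
Unset Printing Implicit Defensive.

Import Order.TTheory GRing.Theory Num.Theory.
Import numFieldNormedType.Exports.

Local Open Scope classical_set_scope.
Local Open Scope ring_scope.

#[short(type="completeMetricType")]
HB.structure Definition CompleteMetric (R : numDomainType) :=
  {T of Metric R T & CompletePseudoMetric R T}.

Definition separable (T : topologicalType) : Prop :=
  exists2 A : set T, countable A & dense A.

Notation borel T := (g_sigma_algebraType (@open T)).

(* sequences in T, with the product (cylinder) sigma-algebra *)
Notation seqspace T := (g_sigma_algebraType
  (\bigcup_(i in [set: nat])
     preimage_set_system [set: nat -> T] (fun y => y i) (@measurable _ T%type))).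

Section laws.
Context {d d1 d2 : measure_display} {Omega : measurableType d} {R : realType}.
Variable P : probability Omega R.
Local Open Scope ereal_scope.

Definition same_law {T : measurableType d1} (U V : Omega -> T) : Prop :=
  forall A : set T, measurable A -> P (U @^-1` A) = P (V @^-1` A).

Definition independent {T1 : measurableType d1} {T2 : measurableType d2}
    (U : Omega -> T1) (V : Omega -> T2) : Prop :=
  forall (A : set T1) (B : set T2), measurable A -> measurable B ->
    P (U @^-1` A `&` V @^-1` B) = P (U @^-1` A) * P (V @^-1` B).

Definition mutually_independent {T : measurableType d1}
    (D : set nat) (e : nat -> Omega -> T) : Prop :=
  forall (s : seq nat) (B : nat -> set T),
    uniq s -> [set` s] `<=` D -> (forall i, measurable (B i)) ->
    P (\bigcap_(i in [set` s]) (e i @^-1` B i)) =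
      \prod_(i <- s) P (e i @^-1` B i).

Definition iid {T : measurableType d1} (D : set nat) (e : nat -> Omega -> T) :
    Prop :=
  mutually_independent D e /\ forall i j, D i -> D j -> same_law (e i) (e j).

End laws.

Definition rseq {d d1 : measure_display} {Omega : measurableType d}
    {T : measurableType d1} (e : nat -> Omega -> T) : Omega -> seqspace T :=
  fun w i => e i w.

Definition rpair {d d1 d2 : measure_display} {Omega : measurableType d}
    {T1 : measurableType d1} {T2 : measurableType d2}
    (U : Omega -> T1) (V : Omega -> T2) : Omega -> T1 * T2 :=
  fun w => (U w, V w).

Section constants.
Context {R : realType}.

Definition K (k : nat) (rho : R) : R := \sum_(0 <= i < k.+1) rho ^+ i.

(* M^2(n, rho) *)
Definition Msq (M : nat -> R) (n : nat) (rho : R) : R :=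
  \sum_(1 <= k < n.+1) (K (n - k) rho * M k) ^+ 2.

Definition Dsum (M : nat -> R) (n : nat) (rho : R) : R :=
  \sum_(1 <= k < n.+1) K (n - k) rho * M k.

(* Only used on [0, +oo[; the value 0 at t = 0 is the continuous extension. *)
Definition ell (t : R) : R :=
  if 0 < t then
    (t - ln t - 1) + t * (expR t - 1)^-1 + ln (1 - expR (- t))
  else 0.

Definition ellstar (x : R) : \bar R :=
  ereal_sup [set (x * t - ell t)%:E | t in [set t : R | 0 < t]].

End constants.

(* The expectation of a real function is extended-real valued; [fine] is the
   coercion back to R, which is meaningful when g is integrable. *)
Definition centered {d : measure_display} {Omega : measurableType d}
    {R : realType} (P : probability Omega R) (g : Omega -> R) : Omega -> R :=
  fun w => g w - fine 'E_P[g]%E.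

(* Main.v *)
Require Import Defs.
From HB Require Import structures.
From mathcomp Require Import all_boot all_order all_algebra.
From mathcomp Require Import all_classical all_reals all_analysis.
From mathcomp Require Import measurable_realfun ess_sup_inf.
From mathcomp Require Import ring lra.

Set Implicit Arguments.
Unset Strict Implicit.
Unset Printing Implicit Defensive.

Import Order.TTheory GRing.Theory Num.Theory.
Import numFieldNormedType.Exports.

Local Open Scope classical_set_scope.
Local Open Scope ring_scope.

(** The function f(X_1, ..., X_n) is decomposed by integrating out one
    innovation at a time, starting with the last one.  Averaging the last
    coordinate F(x_(n-1), y) of a function with Lipschitz weights (1, ..., 1, K_j)
    over the law nu of y leaves a function of n-1 coordinates with weights
    (1, ..., 1, 1 + rho K_j) = (1, ..., 1, K_(j+1)), because F contracts by rho
    in mean.  Given the past, the function that is averaged ranges in an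
    interval of length K_j M_n: two independent values of the innovation move
    the chain by at most M_n, and hence move the function by at most K_j M_n
    ([cont_mgf]).

    A centred variable with range in an interval of length c has a Laplace
    transform at t of at most exp (ell (c |t|)): by convexity it is dominated by
    that of a two-point variable, and ell is the supremum over p of the
    logarithm of the Laplace transform of a centred Bernoulli(p) variable
    ([bernoulli_mgf], [hoeffding_ell]).  Iterating ([chain_mgf]) gives
    E exp (t f) <= exp (t m + sum_k ell (c_k |t|)) for some real m and every
    real t, with c_k = K_(n-k) M_k.  As ell is quadratic near 0, letting t tend
    to 0 from both sides forces E f = m ([mgf_mean]), so that the expectation
    need not be followed through the induction.

    The sum is compared with a single value of ell by Jensen's inequality
    ([ell_jensen]).  With s x = ln (sinh x / x), one has
    ell (2x) = s x + x s' x, where s' = coth x - 1/x is the Langevin function,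
    which is concave on x > 0 by Lazarevic's inequality
    cosh x <= (sinh x / x)^3.  Jensen's inequality for s' with the weights
    c_k / D, and for s by integration, gives
    sum_k ell (c_k t) <= (D^2 / M^2) ell (M^2 t / D).

    The second bound is the exponential Markov inequality ([chernoff_ell]).  The
    third one follows from ell^* y >= (y^2 - 2 y) ln (1 - y), which is obtained
    by evaluating y t - ell t at an explicit t ([ellstar_ge]): t = 4 y for
    y <= 3/8, where a fourth-order bound of ell suffices, and t = 1 / (1 - y) for
    y >= 3/8, where the inequality becomes [tail_gap_ge0]. *)

(** * Derivatives and monotonicity *)

Section calculus.
Context {R : realType}.
Implicit Types (f g : R -> R) (x a b c df dg : R).

Lemma derD f g x df dg : is_derive x 1 f df -> is_derive x 1 g dg ->
  is_derive x 1 (fun y => f y + g y) (df + dg).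
Proof. by move=> hf hg; exact: (@is_deriveD _ _ _ f g x 1 df dg hf hg). Qed.

Lemma derN f x df : is_derive x 1 f df -> is_derive x 1 (fun y => - f y) (- df).
Proof. by move=> hf; exact: (@is_deriveN _ _ _ f x 1 df hf). Qed.

Lemma derM f g x df dg : is_derive x 1 f df -> is_derive x 1 g dg ->
  is_derive x 1 (fun y => f y * g y) (df * g x + f x * dg).
Proof.
move=> hf hg; have := @is_deriveM _ _ f g x 1 df dg hf hg.
by move/is_derive_eq; apply; rewrite /GRing.scale /=; ring.
Qed.

Lemma derX f n x df : is_derive x 1 f df ->
  is_derive x 1 (fun y => f y ^+ n) (n%:R * f x ^+ n.-1 * df).
Proof.
case: n => [|n] hf; first by rewrite mul0r mul0r; exact: is_derive_cst.
have := @is_deriveX _ _ f n.+1 x 1 df hf.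
have -> : (fun y => f y ^+ n.+1) = f ^+ n.+1 by apply/funext => y; rewrite exprfctE.
by move/is_derive_eq; apply; rewrite /GRing.scale /= -mulr_natl; ring.
Qed.

Lemma derV f x df : f x != 0 -> is_derive x 1 f df ->
  is_derive x 1 (fun y => (f y)^-1) (- df / f x ^+ 2).
Proof.
move=> fx0 hf; have := @is_deriveV _ f x df 1 fx0 hf.
by move/is_derive_eq; apply; rewrite /GRing.scale /=; field.
Qed.

Lemma derExp f x df : is_derive x 1 f df ->
  is_derive x 1 (fun y => expR (f y)) (expR (f x) * df).
Proof.
move=> hf; have := @is_derive1_comp _ expR f x _ _ (is_derive_expR (f x)) hf.
by move/is_derive_eq; apply; rewrite mulrC.
Qed.

Lemma derLn f x df : 0 < f x -> is_derive x 1 f df ->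
  is_derive x 1 (fun y => ln (f y)) (df / f x).
Proof.
move=> fx0 hf; have := @is_derive1_comp _ (@ln R) f x _ _ (is_derive1_ln fx0) hf.
by move/is_derive_eq; apply; rewrite mulrC.
Qed.

Lemma derCst c x : is_derive x 1 (fun _ : R => c) 0.
Proof. exact: is_derive_cst. Qed.

Lemma derId x : is_derive x 1 (fun y : R => y) 1.
Proof. exact: is_derive_id. Qed.

(** Leaves the value of the derivative to be proved equal afterwards, so that it
    can first be computed by the structure of the function. *)
Lemma der_eq f x df df' : df = df' -> is_derive x 1 f df -> is_derive x 1 f df'.
Proof. by move=> ->. Qed.

Lemma derive_ge0_le f (df : R -> R) a b : a <= b ->
  (forall y, a <= y <= b -> is_derive y 1 f (df y)) ->
  (forall y, a <= y <= b -> 0 <= df y) -> f a <= f b.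
Proof.
move=> ab hd h0.
have [||c cab hc] := @MVT_segment _ f df a b ab.
- by move=> y; rewrite in_itv /= => /andP[ay yb]; apply: hd; rewrite !ltW.
- apply: derivable_within_continuous => y; rewrite in_itv/= => /hd h.
  exact: ex_derive.
rewrite -subr_ge0 hc mulr_ge0 ?subr_ge0//; apply: h0.
by move: cab; rewrite in_itv.
Qed.

Lemma derive_ge0 f (df : R -> R) x : 0 <= x -> f 0 = 0 ->
  (forall y, 0 <= y <= x -> is_derive y 1 f (df y)) ->
  (forall y, 0 <= y <= x -> 0 <= df y) -> 0 <= f x.
Proof. by move=> x0 f0 hd h; rewrite -[leLHS]f0; exact: derive_ge0_le hd h. Qed.

(** Monotonicity down to 0 for functions such as x |-> ln (sinh x / x), whose
    formula makes no sense at 0: a linear lower bound near 0 replaces continuity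
    at 0. *)
Lemma derive_ge0_cont0 f (df : R -> R) (C : R) x : 0 < x ->
  (forall y, 0 < y <= x -> is_derive y 1 f (df y)) ->
  (forall y, 0 < y <= x -> 0 <= df y) ->
  (forall y, 0 < y <= x -> - (C * y) <= f y) -> 0 <= f x.
Proof.
move=> x0 hd h hC; rewrite leNgt; apply/negP => fx0.
pose C' := `|C| + 1; have C'0 : 0 < C' by rewrite ltr_wpDl.
pose y := Num.min x (- f x / (2 * C')).
have y0 : 0 < y by rewrite lt_min x0 divr_gt0 ?mulr_gt0// oppr_gt0.
have yx : y <= x by rewrite ge_min lexx.
have := @derive_ge0_le f df y x yx.
move=> H; have {}H : f y <= f x.
  by apply: H => z /andP[yz zx]; [apply: hd|apply: h]; rewrite (lt_le_trans y0 yz) zx.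
have := hC y; rewrite y0 yx => /(_ isT) /le_trans /(_ H).
rewrite leNgt => /negP; apply.
have : y <= - f x / (2 * C') by rewrite ge_min lexx orbT.
rewrite ler_pdivlMr ?mulr_gt0// => hy.
have : C * y <= C' * y by rewrite ler_pM2r// (le_trans (ler_norm C))// lerDl.
lra.
Qed.

End calculus.

(** Differentiates by the structure of the function; [tac] handles the leaves. *)
Ltac der_with tac := lazymatch goal with
  | |- is_derive ?x _ (fun _ => ?c) _ => eapply (@derCst _ c x)
  | |- is_derive ?x _ (fun y => y) _ => eapply (@derId _ x)
  | |- is_derive ?x _ (fun y => @?f y + @?g y)%R _ => eapply (@derD _ f g x); der_with tac
  | |- is_derive ?x _ (fun y => @?f y * @?g y)%R _ => eapply (@derM _ f g x); der_with tac
  | |- is_derive ?x _ (fun y => - @?f y)%R _ => eapply (@derN _ f x); der_with tac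
  | |- is_derive ?x _ (fun y => @?f y ^+ ?n)%R _ => eapply (@derX _ f n x); der_with tac
  | |- is_derive ?x _ (fun y => (@?f y)^-1)%R _ => eapply (@derV _ f x); [|der_with tac]
  | |- is_derive ?x _ (fun y => expR (@?f y)) _ => eapply (@derExp _ f x); der_with tac
  | |- is_derive ?x _ (fun y => ln (@?f y)) _ => eapply (@derLn _ f x); [|der_with tac]
  | |- _ => tac
  end.

Ltac der0 := der_with ltac:(try eassumption).

(** * Hyperbolic functions and Lazarevic's inequality *)

Section hyperbolic.
Context {R : realType}.
Implicit Types (f : R -> R) (x df : R).

Definition sh x : R := (expR x - expR (- x)) / 2.
Definition ch x : R := (expR x + expR (- x)) / 2.

Lemma der_sh f x df : is_derive x 1 f df ->
  is_derive x 1 (fun y => sh (f y)) (ch (f x) * df).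
Proof.
move=> hf; rewrite /sh /ch.
by eapply der_eq; [|der0]; field.
Qed.

Lemma der_ch f x df : is_derive x 1 f df ->
  is_derive x 1 (fun y => ch (f y)) (sh (f x) * df).
Proof.
move=> hf; rewrite /sh /ch.
by eapply der_eq; [|der0]; field.
Qed.

Lemma sh0 : sh 0 = 0. Proof. by rewrite /sh oppr0 subrr mul0r. Qed.
Lemma ch_gt0 x : 0 < ch x.
Proof. by rewrite /ch divr_gt0// addr_gt0// expR_gt0. Qed.
Lemma ch_sqr x : ch x ^+ 2 = sh x ^+ 2 + 1.
Proof.
have : expR x * expR (- x) = 1 by rewrite -expRD subrr expR0.
by rewrite /ch /sh => h; nra.
Qed.
Lemma sh_gt0 x : 0 < x -> 0 < sh x.
Proof. by move=> x0; rewrite divr_gt0// subr_gt0 ltr_expR; lra. Qed.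
Lemma sh_ge0 x : 0 <= x -> 0 <= sh x.
Proof. by move=> x0; rewrite divr_ge0// subr_ge0 ler_expR; lra. Qed.
Lemma ch_ge1 x : 1 <= ch x.
Proof.
by rewrite -(@expr_ge1 _ 2)// ?ch_sqr ?lerDr ?sqr_ge0 ?ltW ?ch_gt0.
Qed.

End hyperbolic.

Ltac der := der_with ltac:(idtac; lazymatch goal with
  | |- is_derive ?x _ (fun y => sh (@?f y)) _ => eapply (@der_sh _ f x); der
  | |- is_derive ?x _ (fun y => ch (@?f y)) _ => eapply (@der_ch _ f x); der
  | |- _ => try eassumption end).

Section lazarevic.
Context {R : realType}.
Implicit Types x : R.

(** With W = sh^3 / ch - x^3, the functions W, W' = V and V' = V1 vanish at 0, and
    V1' = sh^4 (8 ch^2 + 6) / ch^4 is nonnegative. *)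
Lemma lazarevic x : 0 <= x -> x ^+ 3 * ch x <= sh x ^+ 3.
Proof.
move=> x0.
pose V (y : R) := 3 * sh y ^+ 2 - sh y ^+ 4 / ch y ^+ 2 - 3 * y ^+ 2.
pose V1 (y : R) := 6 * sh y * ch y - 4 * sh y ^+ 3 / ch y + 2 * sh y ^+ 5 / ch y ^+ 3 - 6 * y.
have chn (y : R) : ch y != 0 by rewrite gt_eqF// ch_gt0.
have V1_ge0 y : 0 <= y -> 0 <= V1 y.
  move=> y0; eapply (@derive_ge0 _ V1 (fun y => sh y ^+ 4 * (8 * ch y ^+ 2 + 6) / ch y ^+
    4) _ y0).
  - by rewrite /V1 sh0; ring.
  - move=> z hz; rewrite /V1. eapply der_eq; [|der].
    2,3: by rewrite ?expf_neq0.
    have := ch_sqr z; move: (chn z); set c := ch z; set s := sh z => c0 cs.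
    have {cs} s2E : s ^+ 2 = c ^+ 2 - 1 by rewrite cs addrK.
    rewrite /=; transitivity (6 * (c ^+ 2 + s ^+ 2) - 12 * s ^+ 2
      + 14 * (s ^+ 2) ^+ 2 / c ^+ 2 - 6 * (s ^+ 2) ^+ 3 / c ^+ 4 - 6); first by field.
    transitivity ((s ^+ 2) ^+ 2 * (8 * c ^+ 2 + 6) / c ^+ 4); last by field.
    by rewrite s2E; field.
  - move=> z _; have c2 : 0 <= ch z ^+ 2 by rewrite sqr_ge0.
    by rewrite divr_ge0 ?exprn_even_ge0// mulr_ge0 ?exprn_even_ge0//; lra.
have V_ge0 y : 0 <= y -> 0 <= V y.
  move=> y0; eapply (@derive_ge0 _ V V1 _ y0).
  - by rewrite /V sh0; ring.
  - move=> z hz; rewrite /V; eapply der_eq; [|der]; last by rewrite expf_neq0.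
    by rewrite /V1 /=; field.
  - by move=> z /andP[z0 _]; exact: V1_ge0.
rewrite -ler_pdivlMr ?ch_gt0// -subr_ge0.
eapply (@derive_ge0 _ (fun y => sh y ^+ 3 / ch y - y ^+ 3) V _ x0).
- by rewrite sh0; ring.
- move=> z hz; eapply der_eq; [|der]; last by [].
  have := ch_sqr z; rewrite /V; move: (chn z); set c := ch z; set s := sh z => c0 cs.
  by rewrite /=; field.
- by move=> z /andP[z0 _]; exact: V_ge0.
Qed.

(** The Langevin function, that is the derivative of [lnshc]; [dlangevin] is its
    own derivative. *)
Definition langevin x : R := ch x / sh x - x^-1.
Definition dlangevin x : R := x ^- 2 - sh x ^- 2.
Definition lnshc x : R := ln (sh x / x).

Lemma der_langevin x : 0 < x -> is_derive x 1 langevin (dlangevin x).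
Proof.
move=> x0; have s0 := sh_gt0 x0.
rewrite /langevin; eapply der_eq; [|der; rewrite ?gt_eqF//].
have c2 := ch_sqr x; rewrite /dlangevin.
transitivity (1 - (ch x) ^+ 2 / sh x ^+ 2 + x^- 2); first by field; rewrite !gt_eqF.
by rewrite c2; field; rewrite !gt_eqF.
Qed.

(** Concavity of the Langevin function: its second derivative is
    2 ch / sh^3 - 2 / x^3, whose sign is Lazarevic's inequality. *)
Lemma dlangevin_decr x y : 0 < x -> x <= y -> dlangevin y <= dlangevin x.
Proof.
move=> x0 xy; rewrite -subr_ge0.
have -> : 0 = dlangevin x - dlangevin x by rewrite subrr.
rewrite lerB// -lerN2.
eapply (@derive_ge0_le _ (fun y => - dlangevin y) (fun y => 2 / y ^+ 3 - 2 * ch y / sh y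
  ^+ 3) _ _ xy).
- move=> z /andP[xz _]; have z0 := lt_le_trans x0 xz; have s0 := sh_gt0 z0.
  rewrite /dlangevin; eapply der_eq; [|der; rewrite ?gt_eqF ?exprn_gt0//].
  by rewrite /=; field; rewrite !gt_eqF.
- move=> z /andP[xz _]; have z0 := lt_le_trans x0 xz; have s0 := sh_gt0 z0.
  have := lazarevic (ltW z0) => h.
  rewrite subr_ge0 ler_pdivrMr ?exprn_gt0// mulrAC ler_pdivlMr ?exprn_gt0//.
  by rewrite -mulrA ler_pM2l// mulrC.
Qed.

Lemma langevin_tangent a x : 0 < a -> 0 < x -> langevin x <= langevin a + dlangevin a * (x - a).
Proof.
move=> a0 x0.
have [ax|/ltW xa] := leP a x.
- have := @derive_ge0_le _ (fun y => dlangevin a * (y - a) - langevin y) (fun y =>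
    dlangevin a - dlangevin y) _ _ ax.
  rewrite subrr mulr0 sub0r => h.
  suff: - langevin a <= dlangevin a * (x - a) - langevin x by lra.
  apply: h => y /andP[ay _]; have y0 := lt_le_trans a0 ay; last by rewrite subr_ge0
    dlangevin_decr.
  have := der_langevin y0 => ?; by eapply der_eq; [|der]; ring.
- have := @derive_ge0_le _ (fun y => langevin y - dlangevin a * (y - a)) (fun y =>
    dlangevin y - dlangevin a) _ _ xa.
  rewrite subrr mulr0 subr0 => h.
  suff: langevin x - dlangevin a * (x - a) <= langevin a by lra.
  apply: h => y /andP[xy ya]; have y0 := lt_le_trans x0 xy; last by rewrite subr_ge0
    dlangevin_decr.
  have := der_langevin y0 => ?; by eapply der_eq; [|der]; ring.
Qed.

Lemma der_lnshc x : 0 < x -> is_derive x 1 lnshc (langevin x).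
Proof.
move=> x0; have s0 := sh_gt0 x0.
rewrite /lnshc; eapply der_eq; [|der; [exact: divr_gt0|by rewrite gt_eqF]].
by rewrite /langevin; field; rewrite !gt_eqF.
Qed.

Lemma sh_ge_id x : 0 <= x -> x <= sh x.
Proof.
move=> x0; rewrite -subr_ge0.
eapply (@derive_ge0 _ (fun y => sh y - y) (fun y => ch y - 1) _ x0).
- by rewrite sh0 subrr.
- by move=> y _; eapply der_eq; [|der]; ring.
- by move=> y _; rewrite subr_ge0 ch_ge1.
Qed.

Lemma lnshc_ge0 x : 0 < x -> 0 <= lnshc x.
Proof. by move=> x0; rewrite ln_ge0// ler_pdivlMr// mul1r sh_ge_id ?ltW. Qed.

Lemma lnshc_le x : 0 < x -> lnshc x <= x.
Proof.
move=> x0; rewrite -ler_expR lnK; last by rewrite posrE divr_gt0// sh_gt0.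
rewrite ler_pdivrMr// /sh.
have e1 : expR x * expR (- (2 * x)) = expR (- x) by rewrite -expRD; congr expR; ring.
have := expR_ge1Dx (- (2 * x)); have := expR_gt0 x; rewrite -e1; nra.
Qed.

(** After the substitution t = 2 x the linear terms of ell cancel and what remains
    is the derivative of x |-> x * lnshc x. *)
Lemma ellE x : 0 < x -> ell (2 * x) = lnshc x + x * langevin x.
Proof.
move=> x0; rewrite /ell mulr_gt0//.
have e0 := expR_gt0 x.
have e1 : 1 < expR (2 * x) by rewrite expR_gt1 mulr_gt0.
have s0 := sh_gt0 x0.
have shE : sh x = expR x * (1 - expR (- (2 * x))) / 2.
  by rewrite mulrBr mulr1 -expRD /sh; congr ((_ - expR _) / 2); ring.
have d0 : 0 < 1 - expR (- (2 * x)) by rewrite subr_gt0 expR_lt1; lra.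
have -> : lnshc x = x + ln (1 - expR (- (2 * x))) - ln (2 * x).
  have -> : lnshc x = ln (expR x * ((1 - expR (- (2 * x))) / (2 * x))).
    by rewrite /lnshc shE; congr ln; field; rewrite gt_eqF.
  rewrite lnM ?posrE//; last by rewrite divr_gt0// mulr_gt0.
  by rewrite expRK ln_div ?posrE ?mulr_gt0// addrA.
suff -> : langevin x = 1 + 2 * (expR (2 * x) - 1)^-1 - x^-1.
  by field; rewrite gt_eqF//= subr_eq0 gt_eqF.
rewrite /langevin /ch shE; congr (_ - _).
have -> : expR (2 * x) = expR x ^+ 2 by rewrite -expRM_natl.
have eN : expR (- x) = (expR x)^-1 by rewrite expRN.
have e1' : 1 < expR x ^+ 2 by rewrite -expRM_natl.
have -> : expR (- (2 * x)) = (expR x)^-1 ^+ 2 by rewrite -eN -expRM_natl mulrN.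
by rewrite eN; field; rewrite subr_eq0 !gt_eqF.
Qed.

Lemma ell_halfE t : 0 < t -> ell t = lnshc (t / 2) + t / 2 * langevin (t / 2).
Proof.
by move=> t0; rewrite -ellE ?divr_gt0//; congr ell; field.
Qed.

Lemma ell0 : ell 0 = 0 :> R. Proof. by rewrite /ell ltxx. Qed.

(** Jensen's inequality with weights c_i / D at the points c_i t, whose barycentre
    is M2 t / D.  It is applied to the Langevin function, transferred to [lnshc] by
    integrating in t, and the two are added through [ell_halfE]. *)
Lemma ell_jensen (I : finType) (c : I -> R) t (D M2 : R) :
  (forall i, 0 < c i) -> D = \sum_i c i -> M2 = \sum_i c i ^+ 2 ->
  0 < D -> 0 <= t ->
  \sum_i ell (c i * t) <= D ^+ 2 / M2 * ell (M2 * t / D).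
Proof.
move=> c0 DE M2E D0; rewrite le_eqVlt => /predU1P[<-|t0].
  by rewrite mulr0 mul0r ell0 mulr0 big1// => i _; rewrite mulr0 ell0.
have M20 : 0 < M2.
  rewrite M2E lt_neqAle eq_sym sumr_ge0 ?andbT => [|i _]; last exact: sqr_ge0.
  apply/negP => /eqP M20; move: D0; rewrite DE big1 ?ltxx// => i _.
  have /psumr_eq0P := M20; move/(_ (fun i _ => sqr_ge0 (c i)) i isT).
  by move/eqP; rewrite expf_eq0 => /andP[_ /eqP].
have [a aE] : exists a, a = M2 / D by exists (M2 / D).
have a0 : 0 < a by rewrite aE divr_gt0.
have langevin_jensen y : 0 < y -> \sum_i c i * langevin (c i * y) <= D * langevin (a * y).
  move=> y0; apply: (@le_trans _ _ (\sum_i (c i * langevin (a * y) + dlangevin (a * y) *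
    y * (c i ^+ 2 - a * c i)))).
    apply: ler_sum => i _.
    have := @langevin_tangent (a * y) (c i * y); rewrite !mulr_gt0// => /(_ isT isT).
    move/(ler_wpM2l (ltW (c0 i)))/le_trans; apply; rewrite le_eqVlt; apply/orP; left;
      apply/eqP; ring.
  rewrite big_split/= -mulr_suml -mulr_sumr sumrB -mulr_sumr -DE -M2E.
  by rewrite aE divfK ?gt_eqF// subrr mulr0 addr0.
have lnshc_jensen y : 0 < y -> \sum_i lnshc (c i * y) <= D ^+ 2 / M2 * lnshc (a * y).
  move=> y0; rewrite -subr_ge0.
  apply: (@derive_ge0_cont0 _ (fun y => D ^+ 2 / M2 * lnshc (a * y) - \sum_i lnshc (c i * y))
    (fun y => D * langevin (a * y) - \sum_i c i * langevin (c i * y)) D y y0).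
  - move=> z /andP[z0 _].
    have dl b : 0 < b -> is_derive z 1 (fun y => lnshc (b * y)) (b * langevin (b * z)).
      move=> b0; have := @is_derive1_comp _ lnshc (fun y => b * y) z _ _ (der_lnshc
        (mulr_gt0 b0 z0)).
      move=> /(_ b) h; eapply der_eq; [|apply: h].
        by rewrite mulrC.
      by eapply der_eq; [|der]; ring.
    have hs : is_derive z 1 (fun y => \sum_i lnshc (c i * y)) (\sum_i c i * langevin (c i * z)).
      have -> : (fun y => \sum_i lnshc (c i * y)) = \sum_i (fun y => lnshc (c i * y)).
        by apply/funext => w; rewrite fct_sumE.
      elim/big_rec2: _ => [|i f' f _ hf]; first exact: derCst.
      by apply: derD => //; exact: dl.
    have := dl a a0 => ha.
    eapply der_eq; [|der].
    by rewrite aE; field; rewrite !gt_eqF.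
  - by move=> z /andP[z0 _]; rewrite subr_ge0 langevin_jensen.
  - move=> z /andP[z0 _].
    have h1 : 0 <= D ^+ 2 / M2 * lnshc (a * z).
      by rewrite mulr_ge0 ?divr_ge0 ?sqr_ge0 ?(ltW M20) ?lnshc_ge0// mulr_gt0.
    have h2 : \sum_i lnshc (c i * z) <= D * z.
      by rewrite DE mulr_suml; apply: ler_sum => i _; rewrite lnshc_le// mulr_gt0.
    lra.
have -> : \sum_i ell (c i * t) = \sum_i lnshc (c i * (t / 2)) + t / 2 * \sum_i (c i *
  langevin (c i * (t / 2))).
  rewrite mulr_sumr -big_split/=; apply: eq_bigr => i _.
  rewrite ell_halfE ?mulr_gt0//; have -> : c i * t / 2 = c i * (t / 2) by ring.
  by congr (_ + _); ring.
have -> : M2 * t / D = a * t by rewrite aE; ring.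
rewrite ell_halfE ?mulr_gt0// -(mulrA a) mulrDr; have t20 : 0 < t / 2 by rewrite divr_gt0.
apply: lerD; first exact: lnshc_jensen.
have -> : D ^+ 2 / M2 * (a * (t / 2) * langevin (a * (t / 2))) = t / 2 * (D * langevin (a
  * (t / 2))).
  by rewrite aE; field; rewrite !gt_eqF.
by rewrite ler_pM2l// langevin_jensen.
Qed.
End lazarevic.

(** * Bounds of ell and of the logarithm near 0 *)

Section small.
Context {R : realType}.
Implicit Types x y t : R.

Lemma sh_le_ch x : 0 <= x -> sh x <= x * ch x.
Proof.
move=> x0; rewrite -subr_ge0.
eapply (@derive_ge0 _ (fun y => y * ch y - sh y) (fun y => y * sh y) _ x0).
- by rewrite sh0 mul0r subrr.
- by move=> y _; eapply der_eq; [|der]; ring.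
- by move=> y /andP[y0 _]; rewrite mulr_ge0// sh_ge0.
Qed.

(** The Taylor expansion starts with x / 3 - x^3 / 45; lowering 1/45 to 2/125
    absorbs the remainder up to 3/4.  Multiplied by x * sh x, the difference of
    the two sides vanishes at 0 together with its successive derivatives, once a
    factor x is taken out of each of the first two. *)
Lemma langevin_le x : 0 < x -> x <= 3 / 4 -> langevin x <= x / 3 - 2 / 125 * x ^+ 3.
Proof.
move=> x0 x34; have s0 := sh_gt0 x0.
pose f2 y := sh y * (1 / 3 - 16 / 125 - 2 / 125 * y ^+ 2) - 14 / 125 * y * ch y.
have f2_ge0 y : 0 <= y -> y <= 3 / 4 -> 0 <= f2 y.
  move=> y0 y34; apply: (@derive_ge0 _ f2 (fun y => ch y * (1 / 3 - 30 / 125 - 2 / 125 *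
    y ^+ 2) - 18 / 125 * y * sh y) _ y0).
  - by rewrite /f2 sh0; ring.
  - by move=> z _; rewrite /f2; eapply der_eq; [|der]; rewrite /=; field.
  - move=> z /andP[z0 zy]; have := sh_le_ch z0; have := ch_gt0 z => c0 h.
    have : z * sh z <= z * (z * ch z) by rewrite ler_wpM2l.
    have : 0 <= ch z * ((3 / 4) ^+ 2 - z ^+ 2).
      by rewrite mulr_ge0 ?(ltW c0)// subr_ge0; nra.
    nra.
pose f1 y := ch y * (y / 3 - 2 / 125 * y ^+ 3) - sh y * (1 / 3 + 8 / 125 * y ^+ 2).
have f1_ge0 y : 0 <= y -> y <= 3 / 4 -> 0 <= f1 y.
  move=> y0 y34; apply: (@derive_ge0 _ f1 (fun y => y * f2 y) _ y0).
  - by rewrite /f1 sh0; ring.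
  - by move=> z _; rewrite /f1 /f2; eapply der_eq; [|der]; rewrite /=; field.
  - by move=> z /andP[z0 zy]; rewrite mulr_ge0 ?f2_ge0// (le_trans zy).
have f0_ge0 : 0 <= sh x * (1 + x ^+ 2 / 3 - 2 / 125 * x ^+ 4) - x * ch x.
  apply: (@derive_ge0 _ (fun y => sh y * (1 + y ^+ 2 / 3 - 2 / 125 * y ^+ 4) - y * ch y)
    (fun y => y * f1 y) _ (ltW x0)).
  - by rewrite sh0; ring.
  - by move=> z _; rewrite /f1; eapply der_eq; [|der]; rewrite /=; field.
  - by move=> z /andP[z0 zy]; rewrite mulr_ge0 ?f1_ge0// (le_trans zy).
rewrite -subr_ge0.
have -> : x / 3 - 2 / 125 * x ^+ 3 - langevin x =
   (sh x * (1 + x ^+ 2 / 3 - 2 / 125 * x ^+ 4) - x * ch x) / (x * sh x).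
  by rewrite /langevin; field; rewrite !gt_eqF.
by rewrite divr_ge0// mulr_ge0 ?ltW.
Qed.

Lemma lnshc_le4 x : 0 < x -> x <= 3 / 4 -> lnshc x <= x ^+ 2 / 6 - x ^+ 4 / 250.
Proof.
move=> x0 x34; rewrite -subr_ge0.
apply: (@derive_ge0_cont0 _ (fun y => y ^+ 2 / 6 - y ^+ 4 / 250 - lnshc y)
  (fun y => y / 3 - 2 / 125 * y ^+ 3 - langevin y) 1 x x0).
- move=> y /andP[y0 yx]; have := der_lnshc y0 => ?.
  by eapply der_eq; [|der]; rewrite /=; field.
- by move=> y /andP[y0 yx]; rewrite subr_ge0 langevin_le// (le_trans yx).
- move=> y /andP[y0 yx]; have := lnshc_le y0.
  have : 0 <= y ^+ 2 * (1 - y ^+ 2) by rewrite mulr_ge0 ?sqr_ge0// subr_ge0; nra.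
  nra.
Qed.

(** The expansion is t^2 / 8 - t^4 / 576 + ...; the quartic gain is what makes the
    choice t = 4 y sufficient in [ellstar_ge]. *)
Lemma ell_le t : 0 < t -> t <= 3 / 2 -> ell t <= t ^+ 2 / 8 - t ^+ 4 / 800.
Proof.
move=> t0 t32; rewrite ell_halfE//.
have x0 : 0 < t / 2 by lra.
have x34 : t / 2 <= 3 / 4 by lra.
have := lnshc_le4 x0 x34; have := ler_wpM2l (ltW x0) (langevin_le x0 x34); nra.
Qed.

(** The constant 8/25 = 4^4 / 800 matches the quartic term of [ell_le] at t = 4 y. *)
Lemma ln1B_ge y : 0 <= y -> y <= 3 / 8 ->
  - (2 * y - y ^+ 2) * ln (1 - y) <= 2 * y ^+ 2 + 8 / 25 * y ^+ 4.
Proof.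
move=> y0 y38.
have : 0 <= (2 * y + 8 / 25 * y ^+ 3) / (2 - y) + ln (1 - y).
  apply: (@derive_ge0 _ (fun y => (2 * y + 8 / 25 * y ^+ 3) / (2 - y) + ln (1 - y))
     (fun y => y ^+ 2 * (23 / 25 - 64 / 25 * y + 16 / 25 * y ^+ 2) / ((2 - y) ^+ 2 * (1 -
       y))) _ y0).
  - by rewrite /= !subr0 ln1; ring.
  - move=> z /andP[z0 zy]; have ? : 0 < 2 - z by lra. have ? : 0 < 1 - z by lra.
    eapply der_eq; [|der; rewrite ?gt_eqF//].
    by rewrite /=; field; rewrite !gt_eqF.
  - move=> z /andP[z0 zy]; rewrite divr_ge0// mulr_ge0 ?sqr_ge0//; try lra.
    nra.
have y2 : 0 < 2 - y by lra.
move=> h; have : 0 <= y * ((2 - y) * ((2 * y + 8 / 25 * y ^+ 3) / (2 - y) + ln (1 - y))).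
  by rewrite mulr_ge0// mulr_ge0// ltW.
have -> : (2 - y) * ((2 * y + 8 / 25 * y ^+ 3) / (2 - y) + ln (1 - y)) =
  2 * y + 8 / 25 * y ^+ 3 + (2 - y) * ln (1 - y) by field; rewrite gt_eqF.
by move=> {}h; rewrite -subr_ge0; apply: le_trans h _; rewrite le_eqVlt; apply/orP; left;
  apply/eqP; ring.
Qed.

Lemma ln1B_le z : 0 <= z -> z < 1 -> ln (1 - z) <= - z - z ^+ 2 / 2 :> R.
Proof.
move=> z0 z1; rewrite -subr_ge0.
apply: (@derive_ge0 _ (fun z => - z - z ^+ 2 / 2 - ln (1 - z))
     (fun z => z ^+ 2 / (1 - z)) _ z0).
- by rewrite /= !subr0 ln1; ring.
- move=> y /andP[y0 yz]; have ? : 0 < 1 - y by lra.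
  eapply der_eq; [|der; rewrite ?gt_eqF//].
  by rewrite /=; field; rewrite !gt_eqF.
- by move=> y /andP[y0 yz]; rewrite divr_ge0 ?sqr_ge0//; lra.
Qed.

End small.

(** * The range t >= 8/5 *)

Section large.
Context {R : realType}.
Implicit Types x y t : R.

Lemma expR_ge_taylor3 x : 1 + x + x ^+ 2 / 2 + x ^+ 3 / 6 <= expR x.
Proof.
rewrite -subr_ge0; have [x0|x0] := leP 0 x.
  have h1 y : 0 <= y -> 0 <= expR y - 1 - y - y ^+ 2 / 2.
    move=> y0; apply: (@derive_ge0 _ (fun y => expR y - 1 - y - y ^+ 2 / 2) (fun y =>
      expR y - 1 - y) _ y0).
    + by rewrite /= expR0; ring.
    + by move=> z _; eapply der_eq; [|der]; rewrite /=; field.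
    + by move=> z _; have := expR_ge1Dx z; lra.
  apply: (@derive_ge0 _ (fun y => expR y - (1 + y + y ^+ 2 / 2 + y ^+ 3 / 6)) (fun y =>
    expR y - 1 - y - y ^+ 2 / 2) _ x0).
  + by rewrite /= expR0; ring.
  + by move=> z _; eapply der_eq; [|der]; rewrite /=; field.
  + by move=> z /andP[z0 _]; exact: h1.
have h1 y : 0 <= y -> 0 <= 1 - y + y ^+ 2 / 2 - expR (- y).
  move=> y0; apply: (@derive_ge0 _ (fun y => 1 - y + y ^+ 2 / 2 - expR (- y)) (fun y =>
    expR (- y) - 1 + y) _ y0).
  + by rewrite /= oppr0 expR0; ring.
  + by move=> z _; eapply der_eq; [|der]; rewrite /=; field.
  + by move=> z _; have := expR_ge1Dx (- z); lra.
have nx0 : 0 <= - x by lra.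
have := @derive_ge0 _ (fun y => expR (- y) - (1 - y + y ^+ 2 / 2 - y ^+ 3 / 6)) (fun y =>
  1 - y + y ^+ 2 / 2 - expR (- y)) _ nx0.
rewrite /= opprK => h.
have -> : expR x - (1 + x + x ^+ 2 / 2 + x ^+ 3 / 6) = expR x - (1 + x + (- x) ^+ 2 / 2 -
  (- x) ^+ 3 / 6) by field.
apply: h.
+ by rewrite oppr0 expR0; ring.
+ by move=> z _; eapply der_eq; [|der]; rewrite /=; field.
+ by move=> z /andP[z0 _]; exact: h1.
Qed.

(** Numerical lower bounds of exponentials: the cubic Taylor polynomial is accurate
    at small arguments, and powers reach the others. *)
Lemma expR_ge_pow n (a b : R) : 0 <= b -> b <= 1 + a + a ^+ 2 / 2 + a ^+ 3 / 6 ->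
  b ^+ n <= expR (n%:R * a).
Proof.
move=> b0 hb; rewrite expRM_natl lerXn2r ?nnegrE ?expR_ge0//.
exact: le_trans (expR_ge_taylor3 a).
Qed.

Lemma expR2_ge : 59 / 8 <= expR 2 :> R.
Proof.
have -> : 2 = 8%:R * (1 / 4) :> R by field.
by apply: le_trans (@expR_ge_pow 8 (1 / 4) (95 / 74) _ _); lra.
Qed.

Lemma expRN2_ge : 27 / 200 <= expR (- 2) :> R.
Proof.
have -> : - 2 = 8%:R * (- (1 / 4)) :> R by field.
by apply: le_trans (@expR_ge_pow 8 (- (1 / 4)) (102 / 131) _ _); lra.
Qed.

Lemma expRN8_5_le : expR (- (8 / 5)) <= 99 / 490 :> R.
Proof.
have h : 490 / 99 <= expR (8 / 5) :> R.
  have -> : 8 / 5 = 8%:R * (1 / 5) :> R by field.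
  by apply: le_trans (@expR_ge_pow 8 (1 / 5) (149 / 122) _ _); lra.
have p : 0 < 99 / 490 :> R by lra.
rewrite expRN invf_ple ?posrE ?expR_gt0 ?p// invf_div; exact: h.
Qed.

Lemma ln8_5_ge : 117 / 250 <= ln (8 / 5) :> R.
Proof.
rewrite -ler_expR lnK ?posrE; last by lra.
have p : 0 < 8 / 5 :> R by lra.
rewrite -[expR _]invrK -expRN invf_ple ?posrE ?expR_gt0 ?p// invf_div.
have -> : - (117 / 250) = 2%:R * (- (117 / 500)) :> R by field.
by apply: le_trans (@expR_ge_pow 2 (- (117 / 500)) (34 / 43) _ _); lra.
Qed.

(** At y = 1 - 1/t, this is t^2 times the amount by which y t - ell t exceeds the
    power bound -(2 y - y^2) ln (1 - y). *)
Definition tail_gap t : R := ln t - t ^+ 2 * (t * (expR (- t) / (1 - expR (- t))) + ln (1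
  - expR (- t))).

Lemma expRN_ge t : 27 / 200 * (3 - t) <= expR (- t).
Proof.
have -> : - t = - 2 + (2 - t) by ring.
rewrite expRD; have := expR_ge1Dx (2 - t); have := expRN2_ge; have := expR_ge0 (2 - t).
have [|/ltW] := leP 0 (3 - t); last by move=> ? h1 h2 h3; apply: (@le_trans _ _ 0);
  [nra|rewrite mulr_ge0 ?expR_ge0].
by move=> t3 h1 h2 h3; apply: ler_pM; lra.
Qed.

Lemma sqr_expRN_le t : 0 <= t -> expR (- t) * t ^+ 2 <= 4 / (59 / 8).
Proof.
move=> t0.
have h : (t / 2) ^+ 2 <= expR (t - 2).
  have -> : t - 2 = 2 * (t / 2 - 1) by field.
  rewrite (expRM_natl 2) lerXn2r ?nnegrE ?expR_ge0 ?divr_ge0//.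
  by have := expR_ge1Dx (t / 2 - 1); lra.
have {}h : expR (- t) * t ^+ 2 <= 4 * expR (- 2).
  have -> : expR (- 2) = expR (- t) * expR (t - 2) by rewrite -expRD; congr expR; ring.
  by have := ler_wpM2l (expR_ge0 (- t)) h; nra.
apply: le_trans h _; rewrite ler_pM2l// expRN lef_pV2 ?posrE ?expR_gt0//.
exact: expR2_ge.
Qed.

(** Nonnegative at 8/5 by numerical bounds, and increasing: with z = exp (-t) and
    v = t / (1 - z), t times the derivative is at least
    1 - z t^2 (2 - z - (v - 2)^2), where z t^2 is at most its value 4 exp (-2) at
    t = 2, and the last factor is small since v exceeds 2 around that point. *)
Lemma tail_gap_ge0 t : 8 / 5 <= t -> 0 <= tail_gap t.
Proof.
move=> ht; apply: (@le_trans _ _ (tail_gap (8 / 5))).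
  rewrite /tail_gap; have := expRN8_5_le; have := expR_gt0 (- (8 / 5) : R).
  set z := expR _ => z0 z1; have z1' : z < 1 by lra.
  have := ln1B_le (ltW z0) z1'; have := ln8_5_ge => h1 h2.
  have w0 : 0 < 1 - z by lra.
  have h3 : 8 / 5 * (z / (1 - z)) <= z + z ^+ 2 / 2 + 117 / 640.
    rewrite mulrA ler_pdivrMr//.
    have : 0 <= z * (99 / 490 - z) by apply: mulr_ge0; lra.
    have : 0 <= z ^+ 2 * (99 / 490 - z) by apply: mulr_ge0; [exact: sqr_ge0|lra].
    lra.
  lra.
have h5 : 0 < 8 / 5 :> R by lra.
pose dg (t : R) := let z := expR (- t) in let w := 1 - z in
  t^-1 - (2 * t * (t * (z / w) + ln w) + t ^+ 2 * (2 * (z / w) - t * z / w ^+ 2)).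
apply: (@derive_ge0_le _ tail_gap dg _ _ ht) => y /andP[h8y _]; have y0 := lt_le_trans h5 h8y.
  have e1 : expR (- y) < 1 by rewrite expR_lt1; lra.
  have ? : 0 < 1 - expR (- y) by lra.
  rewrite /tail_gap; eapply der_eq; [|der; rewrite ?gt_eqF//].
  by rewrite /dg /=; field; rewrite !gt_eqF.
have zge := expRN_ge y; have zle := sqr_expRN_le (ltW y0).
have e1 : expR (- y) < 1 by rewrite expR_lt1; lra.
rewrite /dg; move: (expR_gt0 (- y)) e1 zge zle; set z := expR (- y) => z0 z1 zge zle.
have w0 : 0 < 1 - z by lra.
have hl := ln1B_le (ltW z0) z1.
rewrite /= -(pmulr_rge0 _ y0).
pose v := y / (1 - z).
have h : 1 - z * y ^+ 2 * (2 - z - (v - 2) ^+ 2) <=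
  y * (y^-1 - (2 * y * (y * (z / (1 - z)) + ln (1 - z)) + y ^+ 2 * (2 * (z / (1 - z)) - y
    * z / (1 - z) ^+ 2))).
  have -> : y * (y^-1 - (2 * y * (y * (z / (1 - z)) + ln (1 - z)) + y ^+ 2 * (2 * (z / (1
    - z)) - y * z / (1 - z) ^+ 2))) =
    1 - 2 * y ^+ 2 * (z * v + ln (1 - z)) - 2 * y ^+ 2 * z * v + y ^+ 2 * z * v ^+ 2.
    by rewrite /v; field; rewrite !gt_eqF.
  have := ler_wpM2l (sqr_ge0 y) hl; nra.
apply: le_trans h; rewrite subr_ge0.
have vge : y * (1 + z) <= v.
  by rewrite /v ler_pdivlMr// -mulrA ler_piMr ?(ltW y0)//; nra.
have hb : 2 - z - (v - 2) ^+ 2 <= 59 / 32.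
  (* Tangent of the square at 1/5, chosen close to the values of v - 2 near t = 2. *)
  have hs : 2 / 5 * (v - 2) - 1 / 25 <= (v - 2) ^+ 2.
    by have := sqr_ge0 (v - 2 - 1 / 5); lra.
  have [h18|h18] := leP y (9 / 5); first by have := sqr_ge0 (v - 2); lra.
  suff : 157 / 800 <= z + 2 / 5 * (y * (1 + z) - 2) by lra.
  have [h25|h25] := leP (5 / 2) y.
    have : 0 <= y * z by apply: mulr_ge0; lra.
    lra.
  have : 0 <= y * (z - 27 / 200 * (3 - y)) by apply: mulr_ge0; lra.
  have : 0 <= (y - 9 / 5) * (5 / 2 - y) by apply: mulr_ge0; lra.
  lra.
have : z * y ^+ 2 * (2 - z - (v - 2) ^+ 2) <= z * y ^+ 2 * (59 / 32).
  by rewrite ler_wpM2l// mulr_ge0 ?sqr_ge0// (ltW z0).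
by move/le_trans; apply; lra.
Qed.

End large.

(** * The transform of ell, and ell as a bound of Bernoulli Laplace transforms *)

Section legendre.
Context {R : realType}.
Implicit Types x y t q s u : R.

Lemma ellstar_ub x t : 0 < t -> ((x * t - ell t)%:E <= ellstar x)%E.
Proof. by move=> t0; apply: ereal_sup_ubound; exists t. Qed.

Lemma ellE_gap t : 0 < t -> ell t = t - ln t - 1 + (ln t - tail_gap t) / t ^+ 2.
Proof.
move=> t0; rewrite /ell t0 /tail_gap -addrA; congr (_ + _).
have e1 : 1 < expR t by rewrite expR_gt1.
rewrite subKr [RHS]mulrC mulKf ?expf_neq0 ?gt_eqF//; congr (_ * _ + _).
by rewrite expRN; field; rewrite subr_eq0 !gt_eqF ?expR_gt0.
Qed.

(** The supremum is bounded below by its value at one t.  The optimum behaves as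
    4 y for small y and as 1 / (1 - y) for y near 1; each of these choices is good
    enough on its side of 3/8. *)
Lemma ellstar_ge y : 0 < y -> y < 1 ->
  ((- (2 * y - y ^+ 2) * ln (1 - y))%:E <= ellstar y)%E.
Proof.
move=> y0 y1; have [y38|y38] := leP y (3 / 8).
  apply: le_trans (ellstar_ub y (t := 4 * y) _); last by rewrite mulr_gt0.
  rewrite lee_fin; apply: le_trans (ln1B_ge (ltW y0) y38) _.
  have := @ell_le _ (4 * y); rewrite mulr_gt0// => /(_ isT) h.
  have : 4 * y <= 3 / 2 by lra.
  move/h; lra.
pose t := (1 - y)^-1.
have w0 : 0 < 1 - y by lra.
have t0 : 0 < t by rewrite invr_gt0.
apply: le_trans (ellstar_ub y t0); rewrite lee_fin ellE_gap//.
have yE : y = 1 - t^-1 by rewrite /t invrK; ring.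
have -> : ln (1 - y) = - ln t by rewrite /t lnV ?posrE// opprK.
have t85 : 8 / 5 <= t.
  by rewrite /t -[leRHS]div1r ler_pdivlMr//; lra.
rewrite yE -subr_ge0.
have -> : (1 - t^-1) * t - (t - ln t - 1 + (ln t - tail_gap t) / t ^+ 2) -
  - (2 * (1 - t^-1) - (1 - t^-1) ^+ 2) * - ln t = tail_gap t / t ^+ 2.
  by field; rewrite gt_eqF.
by rewrite divr_ge0 ?tail_gap_ge0 ?sqr_ge0.
Qed.

(** At y = 1 the function t - ell t grows as ln t. *)
Lemma ellstar1 : ellstar 1 = +oo%E :> \bar R.
Proof.
apply: eq_infty => A.
apply: le_trans (ellstar_ub 1 (expR_gt0 A)); rewrite lee_fin mul1r.
rewrite /ell expR_gt0 expRK.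
have t0 := expR_gt0 A; set t := expR A.
have et : t <= expR t - 1 by have := expR_ge1Dx t; lra.
have h1 : t * (expR t - 1)^-1 <= 1.
  by rewrite ler_pdivrMr ?mul1r// (lt_le_trans t0).
have h2 : ln (1 - expR (- t)) <= 0.
  by rewrite ln_le0// gerBl expR_ge0.
lra.
Qed.

Lemma powR_bound (D M2 x : R) : 0 < D -> 0 < M2 -> 0 < x -> x <= D ->
  (expeR (- ((D ^+ 2 / M2)%:E * ellstar (x / D))) <=
   (((D - x) / D) `^ ((2 * D * x - x ^+ 2) / M2))%:E)%E.
Proof.
move=> D0 M20 x0 xD.
have q0 : 0 < D ^+ 2 / M2 by rewrite divr_gt0// exprn_gt0.
move: xD; rewrite le_eqVlt => /predU1P[->|xD].
  rewrite divff ?gt_eqF// ellstar1 gt0_muley ?lte_fin//=.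
  by rewrite lee_fin powR_ge0.
pose y := x / D; have y0 : 0 < y by rewrite divr_gt0.
have y1 : y < 1 by rewrite ltr_pdivrMr// mul1r.
have -> : (D - x) / D = 1 - y by rewrite /y; field; rewrite gt_eqF.
have w0 : 0 < 1 - y by lra.
rewrite /powR gt_eqF//.
have -> : (expR ((2 * D * x - x ^+ 2) / M2 * ln (1 - y)))%:E = expeR ((2 * D * x - x ^+
  2) / M2 * ln (1 - y))%:E by [].
rewrite lee_expeR leeNl.
apply: le_trans (lee_wpmul2l _ (ellstar_ge y0 y1)); last by rewrite lee_fin ltW.
rewrite -EFinM -EFinN lee_fin le_eqVlt; apply/orP; left; apply/eqP.
by rewrite /y; field; rewrite !gt_eqF.
Qed.

(** The logarithm of the left-hand side, minus q s, is concave in q and its maximum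
    over q is ell s: use the tangent of the logarithm at (exp s - 1) / s, the value
    of the argument at the maximiser. *)
Lemma bernoulli_mgf_pos q s : 0 <= q -> q <= 1 -> 0 < s ->
  1 - q + q * expR s <= expR (q * s + ell s).
Proof.
move=> q0 q1 s0; have e1 : 1 < expR s by rewrite expR_gt1.
have v0 : 0 < 1 - q + q * expR s by nra.
rewrite -[leLHS]lnK ?posrE// ler_expR.
pose a := (expR s - 1) / s.
have a0 : 0 < a by rewrite divr_gt0// subr_gt0.
set v := (X in ln X).
have -> : ln v = ln a + ln (1 + (v / a - 1)).
  rewrite -lnM ?posrE//; last by rewrite addrCA subrr addr0 divr_gt0.
  by congr ln; field; rewrite gt_eqF.
have va : -1 < v / a - 1 by rewrite ltrBDr addrC subrr divr_gt0.
have := le_ln1Dx va.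
suff -> : q * s + ell s = ln a + (v / a - 1) by rewrite lerD2l.
rewrite /ell s0 /a ln_div ?posrE ?subr_gt0//.
have -> : ln (expR s - 1) = s + ln (1 - expR (- s)).
  have -> : expR s - 1 = expR s * (1 - expR (- s)).
    by rewrite mulrBr mulr1 expRN divff// gt_eqF ?expR_gt0.
  by rewrite lnM ?posrE ?expR_gt0 ?expRK// subr_gt0 expR_lt1 oppr_lt0.
by rewrite /v; field; rewrite subr_eq0 !gt_eqF.
Qed.

(** A negative s reduces to a positive one by exchanging q and 1 - q. *)
Lemma bernoulli_mgf q s : 0 <= q -> q <= 1 ->
  1 - q + q * expR s <= expR (q * s + ell `|s|).
Proof.
move=> q0 q1; have [s0|s0|->] := ltgtP s 0.
- have := @bernoulli_mgf_pos (1 - q) (- s).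
  rewrite subr_ge0 gerBl oppr_gt0 => /(_ q1 q0 s0) h.
  rewrite ltr0_norm//.
  have -> : 1 - q + q * expR s = expR s * (1 - (1 - q) + (1 - q) * expR (- s)).
    by rewrite expRN; field; rewrite gt_eqF ?expR_gt0.
  have -> : q * s + ell (- s) = s + ((1 - q) * - s + ell (- s)) by ring.
  by rewrite expRD ler_pM2l ?expR_gt0.
- by rewrite gtr0_norm// bernoulli_mgf_pos.
- by rewrite normr0 ell0 mulr0 addr0 expR0; lra.
Qed.

Lemma expR_chord u s : 0 <= u -> u <= 1 -> expR (u * s) <= 1 - u + u * expR s.
Proof.
move=> u0 u1.
have h1 : expR (u * s) * (1 - u * s) <= 1.
  have := ler_wpM2l (expR_ge0 (u * s)) (expR_ge1Dx (- (u * s))).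
  by rewrite -expRD subrr expR0.
have h2 : expR (u * s) * (1 + (1 - u) * s) <= expR s.
  have := ler_wpM2l (expR_ge0 (u * s)) (expR_ge1Dx ((1 - u) * s)).
  by rewrite -expRD; congr (_ <= expR _); ring.
have := ler_wpM2l u0 h2.
have : (1 - u) * (expR (u * s) * (1 - u * s)) <= (1 - u) * 1 by rewrite ler_wpM2l// subr_ge0.
lra.
Qed.

End legendre.

(** * Laplace transform of a variable with bounded oscillation *)

Section hoeffding.
Context {R : realType} {d : measure_display} {T : measurableType d}.
Variable nu : probability T R.
Implicit Types (g : T -> R) (c m t : R).

Local Notation mean g := (fine (\int[nu]_x (g x)%:E)%E).

Lemma integral_cst_prob (a : R) : (\int[nu]_x a%:E = a%:E)%E.
Proof.
transitivity (a%:E * nu setT)%E; first exact: integral_cst.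
by rewrite probability_setT mule1.
Qed.

Lemma integrable_affine g a b : nu.-integrable setT (EFin \o g) ->
  nu.-integrable setT (EFin \o (fun x => a + b * g x)).
Proof.
move=> ig.
have -> : EFin \o (fun x => a + b * g x) =
    (fun x => a%:E + b%:E * (g x)%:E)%E by [].
apply: integrableD => //.
  exact: finite_measure_integrable_cst.
exact: integrableZl.
Qed.

Lemma integral_affine g a b : nu.-integrable setT (EFin \o g) ->
  (\int[nu]_x (a + b * g x)%:E = (a + b * mean g)%:E)%E.
Proof.
move=> ig; have hfin := integrable_fin_num measurableT ig.
transitivity (\int[nu]_x (a%:E + b%:E * (g x)%:E))%E; first by [].
rewrite integralD//=; last 2 first.
- exact: finite_measure_integrable_cst.
- exact: integrableZl.
rewrite integralZl// integral_cst_prob.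
by rewrite EFinD EFinM fineK.
Qed.

Lemma integrable_bounded g m M : measurable_fun setT g ->
  (forall x, m <= g x <= M) -> nu.-integrable setT (EFin \o g).
Proof.
move=> mg hg; apply: measurable_bounded_integrable => //.
  by apply: le_lt_trans (ltry 1); rewrite -(probability_setT nu).
exists (`|m| + `|M|); split; first by rewrite num_real.
move=> N hN x _; apply/ltW/(le_lt_trans _ hN).
have := hg x; have := ler_norm M; have := ler_norm (- m).
rewrite normrN => h1 h2 /andP[h3 h4].
have := normr_ge0 M; have := normr_ge0 m => h5 h6.
by rewrite ler_norml; lra.
Qed.

Lemma mean_le g h : nu.-integrable setT (EFin \o g) ->
  nu.-integrable setT (EFin \o h) -> (forall x, g x <= h x) -> mean g <= mean h.
Proof.
move=> ig ih gh; apply: fine_le; [exact: integrable_fin_num..|].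
by apply: le_integral => // x _; rewrite lee_fin.
Qed.

(** The chord bounds the exponential on the range of g; as it is affine, its
    integral is the Laplace transform of the two-point law on m and m + c with the
    same mean. *)
Lemma hoeffding_ell_bounded g m c t : measurable_fun setT g -> 0 < c ->
  (forall x, m <= g x <= m + c) ->
  (\int[nu]_x (expR (t * g x))%:E <=
    (expR (t * mean g + ell `|c * t|))%:E)%E.
Proof.
move=> mg c0 hg; have ig := integrable_bounded mg hg.
pose b := expR (t * m) * (expR (c * t) - 1) / c.
pose a := expR (t * m) - b * m.
have icst r : nu.-integrable setT (EFin \o (fun=> r)) := @finite_measure_integrable_cst _
  _ _ nu setT r measurableT.
have mcst r : mean (fun=> r) = r by rewrite integral_cst_prob.
have mE : m <= mean g.
  by rewrite -[leLHS]mcst; apply: mean_le => // x; have /andP[] := hg x.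
have Em : mean g <= m + c.
  by rewrite -[leRHS]mcst; apply: mean_le => // x; have /andP[] := hg x.
have aff y : a + b * y = expR (t * m) * (1 - (y - m) / c + (y - m) / c * expR (c * t)).
  by rewrite /a /b; field; rewrite gt_eqF.
have u01 y : m <= y -> y <= m + c -> 0 <= (y - m) / c /\ (y - m) / c <= 1.
  by move=> h1 h2; rewrite divr_ge0 ?(ltW c0)// ?subr_ge0// ler_pdivrMr//; split=> //; lra.
apply: (@le_trans _ _ (\int[nu]_x (a + b * g x)%:E)%E).
  apply: ge0_le_integral => //.
  - apply/measurable_EFinP; apply: measurableT_comp => //; exact: measurable_funM.
  - apply/measurable_EFinP; apply: measurable_funD => //; exact: measurable_funM.
  - move=> x _; rewrite lee_fin aff; have /andP[h1 h2] := hg x.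
    have [u0 u1] := u01 _ h1 h2.
    have -> : t * g x = t * m + (g x - m) / c * (c * t) by field; rewrite gt_eqF.
    by rewrite expRD ler_pM2l ?expR_gt0// expR_chord.
rewrite integral_affine// lee_fin aff; have [u0 u1] := u01 _ mE Em.
have -> : t * mean g = t * m + (mean g - m) / c * (c * t) by field; rewrite gt_eqF.
by rewrite -(addrA (t * m)) (expRD (t * m)) ler_pM2l ?expR_gt0// bernoulli_mgf.
Qed.

Lemma ae_exists (Q : T -> Prop) : {ae nu, forall y, Q y} -> exists y, Q y.
Proof.
have nu0 : (0 < nu setT)%E by rewrite probability_setT.
have := ae_properfilter_algebraOfSetsType nu0 => ?.
exact: filter_ex.
Qed.

(** Take m to be the essential infimum of g: almost every value of g is at most c
    above almost all the others.  This gives an interval of length c, and not 2 c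
    as bounding g - g y' for one fixed y' would. *)
Lemma ess_range g c : {ae nu, forall y', {ae nu, forall y, `|g y - g y'| <= c}} ->
  exists m, {ae nu, forall y, m <= g y <= m + c}.
Proof.
move=> hg; pose L := ess_inf nu (EFin \o g).
have L1 : {ae nu, forall y', ((g y' - c)%:E <= L)%E}.
  apply: filterS hg => y' hy'; apply/ess_infP; apply: filterS hy' => y.
  by rewrite ler_norml lee_fin => /andP[+ _]; lra.
have L2 : {ae nu, forall y, (L <= (g y)%:E)%E} := ess_inf_le nu (EFin \o g).
have [y1 hy1] := ae_exists L1; have [y2 hy2] := ae_exists L2.
have Lfin : L \is a fin_num.
  by apply/fin_numP; split; apply/eqP => LE; move: hy1 hy2; rewrite LE.
exists (fine L); apply: filterS2 L1 L2 => y.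
by rewrite -(fineK Lfin) !lee_fin => h1 h2; apply/andP; split=> //; lra.
Qed.

Lemma hoeffding_ell g c : measurable_fun setT g -> 0 < c ->
  {ae nu, forall y', {ae nu, forall y, `|g y - g y'| <= c}} ->
  nu.-integrable setT (EFin \o g) /\
  forall t, (\int[nu]_x (expR (t * g x))%:E <=
    (expR (t * mean g + ell `|c * t|))%:E)%E.
Proof.
move=> mg c0 /ess_range[m hm].
(* Truncation turns the almost sure bounds into bounds everywhere. *)
pose h x := Num.max m (Num.min (g x) (m + c)).
have mh : measurable_fun setT h.
  by apply: measurable_maxr => //; exact: measurable_minr.
have hb x : m <= h x <= m + c.
  rewrite /h le_max lexx/= ge_max ge_min lexx orbT andbT; lra.
have gh : ae_eq nu setT (EFin \o g) (EFin \o h).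
  apply: filterS hm => x /andP[h1 h2] _ /=.
  by rewrite /h min_l// max_r.
have ih := integrable_bounded mh hb.
have Eg : (\int[nu]_x (g x)%:E = \int[nu]_x (h x)%:E)%E.
  by apply: ae_eq_integral => //; exact/measurable_EFinP.
have /integrableP[mEh ioh] := ih.
have mEg : measurable_fun setT (EFin \o g) by exact/measurable_EFinP.
split.
  apply/integrableP; split => //.
  have hab : ae_eq nu setT (abse \o (EFin \o g)) (abse \o (EFin \o h)).
    by apply: filterS gh => x /(_ I)/= [->].
  by rewrite (ge0_ae_eq_integral _ _ _ _ _ hab)//; first [exact: measurableT_comp|move=>
    x _; exact: abse_ge0].
move=> t; rewrite Eg; apply: le_trans (hoeffding_ell_bounded t mh c0 hb).
rewrite le_eqVlt; apply/orP; left; apply/eqP.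
apply: ge0_ae_eq_integral => //.
- apply/measurable_EFinP; apply: measurableT_comp => //; exact: measurable_funM.
- apply/measurable_EFinP; apply: measurableT_comp => //; exact: measurable_funM.
- by apply: filterS gh => x /(_ I)/= [->].
Qed.

End hoeffding.

(** * Measurability on sequence spaces *)

Section measurability_lemmas.
Context {R : realType}.

Lemma measurable_fun_ltr_set d (T : measurableType d) (f : T -> R) :
  (forall r, measurable [set x | f x < r]) -> measurable_fun setT f.
Proof.
move=> hf; apply: (measurability _ (RGenInftyO.measurableE R)) => //.
move=> _ [_ [x ->] <-]; rewrite setTI.
by rewrite (_ : _ @^-1` _ = [set y | f y < x])//; apply/seteqP; split => y /=; rewrite in_itv.
Qed.

Lemma open_mdist_lt (X : completeMetricType R) (a : X) (r : R) : open [set x : X | mdist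
  a x < r].
Proof.
rewrite openE => x /= axr; apply/nbhs_ballP; exists (r - mdist a x) => /=.
  by rewrite subr_gt0.
move=> y; rewrite ballEmdist /= ltrBrDl => h.
exact: le_lt_trans (metric_triangle _ _ _) h.
Qed.

Lemma measurable_mdist (X : completeMetricType R) (a : X) :
  measurable_fun [set: borel X] (fun x : borel X => mdist a (x : X) : R).
Proof.
apply: measurable_fun_ltr_set => r; apply: sub_gen_smallest.
exact: open_mdist_lt.
Qed.

Lemma measurable_coord d (T : measurableType d) i :
  measurable_fun setT (fun z : seqspace T => z i).
Proof.
move=> _ A mA; apply: sub_gen_smallest; exists i => //; exists A => //.
Qed.

Lemma measurable_into_seqspace d d' (T : measurableType d) (U : measurableType d')
    (h : U -> seqspace T) :
  (forall i, measurable_fun setT (fun w => h w i)) -> measurable_fun setT h.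
Proof.
move=> hi; apply: (@measurability _ _ _ _ setT h (\bigcup_(i in [set: nat])
  preimage_set_system [set: nat -> T] (fun y => y i) (@measurable _ T))) => //.
move=> _ [_ [i _ [A mA <-]] <-].
by rewrite !setTI; have := hi i measurableT A mA; rewrite setTI.
Qed.

Lemma separable_seq (X : completeMetricType R) : separable X ->
  exists a : nat -> X, forall x e, 0 < e -> exists k, mdist x (a k) < e.
Proof.
move=> [A cA dA]; have /countable_injP[f finj] := cA.
have /choice[a ha] : forall k, exists y, (exists x, A x /\ f x = k) -> A y /\ f y = k.
  move=> k; have [[x hx]|h] := pselect (exists x, A x /\ f x = k); first by exists x.
  by exists point.
exists a => x e e0.
have [y [yx Ay]] : ([set y | mdist x y < e] `&` A) !=set0.
  by apply: dA; [exists x; rewrite /= mdistxx|exact: open_mdist_lt].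
exists (f y); have [A1 A2] := ha (f y) (ex_intro _ y (conj Ay erefl)).
by rewrite (finj _ _ _ _ A2) ?inE.
Qed.

(** A Lipschitz function is the infimum of the cones g q + C * dist (q, z) over a
    countable dense set of q, here the sequences whose first n terms are in the
    dense sequence, encoded by finite lists of indices.  Each cone is measurable for
    the product sigma-algebra because it is a sum of functions of one coordinate. *)
Lemma lipschitz_measurable (X : completeMetricType R) (sepX : separable X)
    (g : seqspace (borel X) -> R) (C : R) n : 0 <= C ->
  (forall z z' : nat -> X, `|g z - g z'| <= C * \sum_(i < n) mdist (z i) (z' i)) ->
  measurable_fun setT g.
Proof.
move=> C0 gL; have [a ha] := separable_seq sepX.
apply: measurable_fun_ltr_set => r.
pose q (s : seq nat) : nat -> X := fun i => a (nth 0%N s i).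
have -> : [set z | g z < r] = \bigcup_(s in [set: seq nat])
    [set z : seqspace (borel X) | g (q s) + C * (\sum_(i < n) mdist (q s i) (z i)) < r].
  apply/seteqP; split => [z /= gzr|z [s _ /=]].
    pose e := (r - g z) / (2 * C * n%:R + 1).
    have d0 : 0 < 2 * C * n%:R + 1 by rewrite ltr_wpDl ?mulr_ge0.
    have e0 : 0 < e by rewrite divr_gt0// subr_gt0.
    have /choice[k hk] : forall i, exists k, mdist (z i : X) (a k) < e.
      by move=> i; exact: ha.
    exists (mkseq k n) => //=.
    have sumle : \sum_(i < n) mdist (q (mkseq k n) i) (z i) <= n%:R * e.
      apply: (@le_trans _ _ (\sum_(i < n) e)); last by rewrite sumr_const card_ord mulr_natl.
      apply: ler_sum => i _; rewrite /q nth_mkseq// metric_sym.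
      exact/ltW/hk.
    have := gL (q (mkseq k n)) z; rewrite ler_norml => /andP[_ h].
    have := ler_wpM2l C0 sumle.
    have : e * (2 * C * n%:R + 1) = r - g z by rewrite /e divfK ?gt_eqF.
    nra.
  have := gL z (q s); rewrite ler_norml => /andP[_ h].
  apply: le_lt_trans; rewrite -lerBlDl; apply: le_trans h _.
  by rewrite le_eqVlt; apply/orP; left; apply/eqP; congr (_ * _); apply: eq_bigr => i _;
    rewrite metric_sym.
apply: countable_bigcupT_measurable; first exact: countableP.
move=> s.
have mh : measurable_fun setT (fun z : seqspace (borel X) => g (q s) + C * (\sum_(i < n)
  mdist (q s i) (z i : X))).
  apply: measurable_funD => //; apply: measurable_funM => //.
  apply: measurable_sum => i.
  exact: (measurableT_comp (measurable_mdist (q s i)) (@measurable_coord _ (borel X) i)).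
have := mh measurableT _ (measurable_itv `]-oo, r[); rewrite setTI.
by congr (measurable _); apply/seteqP; split => y /=; rewrite in_itv.
Qed.

End measurability_lemmas.

(** * Independence and iterated integrals *)

Section independence.
Context {R : realType} {d : measure_display} {Omega : measurableType d}.
Variable P : probability Omega R.

Lemma integral_law d2 (T2 : measurableType d2) (V : Omega -> T2)
    (nu : probability T2 R) (phi : T2 -> \bar R) :
  measurable_fun setT V ->
  (forall B, measurable B -> P (V @^-1` B) = nu B) ->
  measurable_fun setT phi -> (forall y, 0 <= phi y)%E ->
  (\int[nu]_y phi y = \int[P]_w phi (V w))%E.
Proof.
move=> mV lV mphi phi0.
pose Vm := isMeasurableFun.Build _ _ _ _ V mV.
pose Vp : {mfun Omega >-> T2} := HB.pack V Vm.
rewrite -(@ge0_integral_distribution _ _ _ _ _ P Vp phi mphi phi0).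
by apply: eq_measure_integral => A mA _; exact: esym (lV A mA).
Qed.

(** The joint law of an independent pair is the product of the laws, as both
    measures agree on rectangles. *)
Lemma indep_fubini d1 d2 (T1 : measurableType d1) (T2 : measurableType d2)
    (U : Omega -> T1) (V : Omega -> T2) (nu : probability T2 R)
    (phi : T1 * T2 -> \bar R) :
  measurable_fun setT U -> measurable_fun setT V ->
  (forall B, measurable B -> P (V @^-1` B) = nu B) ->
  independent P U V ->
  measurable_fun setT phi -> (forall z, 0 <= phi z)%E ->
  (\int[P]_w phi (U w, V w) = \int[P]_w \int[nu]_y phi (U w, y))%E.
Proof.
move=> mU mV lV iUV mphi phi0.
pose Um := isMeasurableFun.Build _ _ _ _ U mU.
pose Up : {mfun Omega >-> T1} := HB.pack U Um.
have mUV : measurable_fun setT (fun w => (U w, V w)) by exact: measurable_fun_pair.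
pose UVm := isMeasurableFun.Build _ _ _ _ _ mUV.
pose UVp : {mfun Omega >-> (T1 * T2)%type} := HB.pack (fun w => (U w, V w)) UVm.
have <- := @ge0_integral_distribution _ _ _ _ _ P UVp phi mphi phi0.
transitivity (\int[(distribution P Up \x nu)%E]_z phi z)%E.
  apply: eq_measure_integral => A mA _; apply/esym.
  apply: product_measure_unique => // B C mB mC.
  transitivity (P (U @^-1` B) * P (V @^-1` C))%E; first exact: iUV.
  by congr (_ * _)%E; exact: lV.
rewrite fubini_tonelli1//.
apply: (@ge0_integral_distribution _ _ _ _ _ P Up).
  exact: measurable_fun_fubini_tonelli_F.
by move=> x; exact: integral_ge0.
Qed.

Lemma ae_of_integral0 d1 (T1 : measurableType d1) (m : {measure set T1 -> \bar R})
    (h : T1 -> \bar R) :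
  measurable_fun setT h -> (forall u, 0 <= h u)%E -> (\int[m]_u h u = 0)%E ->
  {ae m, forall u, h u = 0%E}.
Proof.
move=> mh h0 ih; have : ae_eq m setT h (cst 0%E).
  apply/(ae_eq_integral_abs m measurableT mh).
  by rewrite -[RHS]ih; apply: eq_integral => u _; rewrite gee0_abs.
by apply: filterS => u /(_ I).
Qed.

Lemma integral_indicC_ae d1 (T1 : measurableType d1) (U : Omega -> T1) (Q : set T1) :
  measurable_fun setT U -> measurable Q -> {ae P, forall w, Q (U w)} ->
  (\int[P]_w (\1_(~` Q) (U w))%:E = 0 :> \bar R)%E.
Proof.
move=> mU mQ hQ; rewrite (ge0_ae_eq_integral _ _ _ _ _ (_ : ae_eq P setT _ (cst 0%E)))//.
- by rewrite integral0.
- apply/measurable_EFinP; apply: measurableT_comp => //.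
  by apply: measurable_indic; exact: measurableC.
- by apply: filterS hQ => w hw _; rewrite indicE memNset//= => /(_ hw).
Qed.

Lemma indicC_eq0 (T : Type) (Q : set T) z : ((\1_(~` Q) z)%:E = 0 :> \bar R)%E -> Q z.
Proof.
rewrite indicE => -[/eqP].
by rewrite pnatr_eq0 eqb0 notin_setE /= => /contrapT.
Qed.

(** A null set of a product has null sections: iterate the integral of its
    indicator. *)
Lemma indep_ae d1 d2 (T1 : measurableType d1) (T2 : measurableType d2)
    (U : Omega -> T1) (V : Omega -> T2) (mu : probability T1 R)
    (nu : probability T2 R) (Q : set (T1 * T2)) :
  measurable_fun setT U -> measurable_fun setT V ->
  (forall B, measurable B -> P (U @^-1` B) = mu B) ->
  (forall B, measurable B -> P (V @^-1` B) = nu B) ->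
  independent P U V -> measurable Q ->
  {ae P, forall w, Q (U w, V w)} -> {ae mu, forall u, {ae nu, forall y, Q (u, y)}}.
Proof.
move=> mU mV lU lV iUV mQ hQ.
pose phi (z : T1 * T2) : \bar R := (\1_(~` Q) z)%:E.
have mphi : measurable_fun setT phi.
  by apply/measurable_EFinP; apply: measurable_indic; exact: measurableC.
have phi0 z : (0 <= phi z)%E by rewrite lee_fin.
have mF := measurable_fun_fubini_tonelli_F (m2 := nu) phi mphi phi0.
have F0 u : (0 <= \int[nu]_y phi (u, y))%E by exact: integral_ge0.
have := indep_fubini mU mV lV iUV mphi phi0.
rewrite (integral_indicC_ae (measurable_fun_pair mU mV) mQ hQ).
rewrite -(integral_law mU lU mF F0) => /esym/(ae_of_integral0 mF F0).
apply: filterS => u hu.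
have mpu : measurable_fun setT (fun y => phi (u, y)).
  exact: (measurableT_comp mphi (measurable_fun_pair (measurable_cst _) (@measurable_id _
    _ _))).
have := ae_of_integral0 mpu (fun y => phi0 (u, y)) hu.
by apply: filterS => y; exact: indicC_eq0.
Qed.

Lemma indep_ae2 d1 d2 d3 (T1 : measurableType d1) (T2 : measurableType d2)
    (T3 : measurableType d3) (U : Omega -> T1) (V : Omega -> T2) (W : Omega -> T3)
    (nu : probability T2 R) (nu' : probability T3 R) (Q : set (T1 * T2 * T3)) :
  measurable_fun setT U -> measurable_fun setT V -> measurable_fun setT W ->
  (forall B, measurable B -> P (V @^-1` B) = nu B) ->
  (forall B, measurable B -> P (W @^-1` B) = nu' B) ->
  independent P U V -> independent P (rpair U V) W -> measurable Q ->
  {ae P, forall w, Q (U w, V w, W w)} ->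
  {ae P, forall w, {ae nu, forall y, {ae nu', forall y', Q (U w, y, y')}}}.
Proof.
move=> mU mV mW lV lW iUV iUVW mQ hQ.
have mUV : measurable_fun setT (rpair U V) := measurable_fun_pair mU mV.
pose phi (z : T1 * T2 * T3) : \bar R := (\1_(~` Q) z)%:E.
have mphi : measurable_fun setT phi.
  by apply/measurable_EFinP; apply: measurable_indic; exact: measurableC.
have phi0 z : (0 <= phi z)%E by rewrite lee_fin.
pose psi (z : T1 * T2) := (\int[nu']_y phi (z, y))%E.
have mpsi : measurable_fun setT psi.
  exact: (measurable_fun_fubini_tonelli_F (m2 := nu') phi mphi phi0).
have psi0 u : (0 <= psi u)%E by exact: integral_ge0.
have mF := measurable_fun_fubini_tonelli_F (m2 := nu) psi mpsi psi0.
have F0 u : (0 <= \int[nu]_y psi (u, y))%E by exact: integral_ge0.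
have := indep_fubini mUV mW lW iUVW mphi phi0.
rewrite (integral_indicC_ae (measurable_fun_pair mUV mW) mQ hQ).
have -> := indep_fubini mU mV lV iUV mpsi psi0.
move=> /esym/(ae_of_integral0 (measurableT_comp mF mU) (fun w => F0 (U w))).
apply: filterS => w hw.
have mpw : measurable_fun setT (fun y => psi (U w, y)).
  exact: (measurableT_comp mpsi (measurable_fun_pair (measurable_cst _) (@measurable_id _
    _ _))).
have := ae_of_integral0 mpw (fun y => psi0 (U w, y)) hw.
apply: filterS => y hy.
have mpy : measurable_fun setT (fun y' => phi (U w, y, y')).
  exact: (measurableT_comp mphi (measurable_fun_pair (measurable_cst _) (@measurable_id _
    _ _))).
have := ae_of_integral0 mpy (fun y' => phi0 (U w, y, y')) hy.
by apply: filterS => y'; exact: indicC_eq0.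
Qed.

Lemma indep_comp d1 d2 d3 d4 (T1 : measurableType d1) (T2 : measurableType d2)
    (T3 : measurableType d3) (T4 : measurableType d4)
    (U : Omega -> T1) (V : Omega -> T2) (g : T1 -> T3) (h : T2 -> T4) :
  measurable_fun setT g -> measurable_fun setT h ->
  independent P U V -> independent P (g \o U) (h \o V).
Proof.
move=> mg mh iUV A B mA mB; apply: (iUV (g @^-1` A) (h @^-1` B)).
- by rewrite -[_ @^-1` _]setTI; exact: mg.
- by rewrite -[_ @^-1` _]setTI; exact: mh.
Qed.

End independence.

(** * Independence of an innovation from the past *)

Section history.
Context {R : realType} {d d1 d2 : measure_display} {Omega : measurableType d}.
Context {T1 : measurableType d1} {T2 : measurableType d2}.
Variable P : probability Omega R.
Variables (X0 : Omega -> T1) (e : nat -> Omega -> T2).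
Hypotheses (mX0 : measurable_fun setT X0) (me : forall i, measurable_fun setT (e i)).
Hypothesis X0_indep : independent P X0 (rseq e).
Hypothesis e_indep : mutually_independent P setT e.

(** A pi-system that generates the sigma-algebra of X0, e 0, ..., e (k - 1). *)
Definition boxes (k : nat) : set (set Omega) :=
  [set S | exists A B, [/\ measurable A, (forall i, measurable (B i)) &
    S = X0 @^-1` A `&` \bigcap_(i in [set` iota 0 k]) (e i @^-1` B i)]].

Let mpre {d3} {T3 : measurableType d3} (h : Omega -> T3) A :
  measurable_fun setT h -> measurable A -> measurable (h @^-1` A).
Proof. by move=> mh mA; rewrite -[_ @^-1` _]setTI; exact: mh. Qed.

Lemma boxes_measurable k : boxes k `<=` measurable.
Proof.
move=> _ [A [B [mA mB ->]]]; apply: measurableI; first exact: mpre.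
by apply: fin_bigcap_measurable => // i _; exact: mpre.
Qed.

Lemma boxes_setI k : setI_closed (boxes k).
Proof.
move=> _ _ [A [B [mA mB ->]]] [A' [B' [mA' mB' ->]]].
exists (A `&` A'), (fun i => B i `&` B' i); split.
- exact: measurableI.
- by move=> i; exact: measurableI.
- rewrite preimage_setI setIACA; congr (_ `&` _).
  by rewrite -bigcapI; apply: eq_bigcapr => i _; rewrite preimage_setI.
Qed.

Lemma boxesT k : boxes k setT.
Proof.
exists setT, (fun=> setT); split => //.
by rewrite preimage_setT setTI bigcapT.
Qed.

Lemma box_prob k A B : measurable A -> (forall i, measurable (B i)) ->
  P (X0 @^-1` A `&` \bigcap_(i in [set` iota 0 k]) (e i @^-1` B i)) =
  (P (X0 @^-1` A) * \prod_(i <- iota 0 k) P (e i @^-1` B i))%E.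
Proof.
move=> mA mB.
pose Z : set (seqspace T2) := \bigcap_(i in [set` iota 0 k]) ((fun y => y i) @^-1` B i).
have mZ : measurable Z.
  apply: fin_bigcap_measurable => // i _.
  by have := @measurable_coord _ T2 i measurableT _ (mB i); rewrite setTI.
rewrite -e_indep ?iota_uniq//.
exact: (X0_indep mA mZ).
Qed.

(** For fixed B, both sides are finite measures in S, so it suffices to compare them
    on the pi-system of boxes, where the intersection with an event of e k is a
    box of the next level. *)
Lemma history_indep k S B : <<s boxes k >> S -> measurable B ->
  (P (S `&` e k @^-1` B) = P S * P (e k @^-1` B))%E.
Proof.
move=> hS mB; have mE : measurable (e k @^-1` B) by exact: mpre.
have pE : 0 <= fine (P (e k @^-1` B)) by rewrite fine_ge0.
pose m1 : {measure set Omega -> \bar R} := mrestr P mE.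
pose m2 : {measure set Omega -> \bar R} := mscale (NngNum pE) P.
have -> : (P S * P (e k @^-1` B))%E = m2 S.
  by rewrite /m2 /= /mscale /= fineK ?fin_num_measure// muleC.
rewrite -[LHS]/(m1 S).
apply: (g_sigma_algebra_measure_unique (boxes k) _ (fun=> setT)) => //.
- exact: boxes_measurable.
- by move=> _; exact: boxesT.
- by rewrite bigcup_const//; exists 0%N.
- exact: boxes_setI.
- move=> _ [A [B' [mA mB' ->]]].
  pose B2 i := if i == k then B else B' i.
  have mB2 i : measurable (B2 i) by rewrite /B2; case: ifP.
  have B2E i : i \in iota 0 k -> B2 i = B' i.
    by rewrite mem_iota /B2 => /andP[_]; rewrite add0n; case: eqP => // ->; rewrite ltnn.
  have iotaE : iota 0 k.+1 = rcons (iota 0 k) k by rewrite -addn1 iotaD cats1.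
  transitivity (P (X0 @^-1` A `&` \bigcap_(i in [set` iota 0 k.+1]) (e i @^-1` B2 i))).
    rewrite iotaE /m1 /= /mrestr -setIA; congr (P (_ `&` _)).
    apply/seteqP; split=> w /=.
      move=> [h1 h2] i /=; rewrite mem_rcons inE => /predU1P[->|ik].
        by rewrite /B2 eqxx.
      by rewrite B2E//; exact: h1.
    move=> h; split=> [i /= ik|].
      by rewrite -B2E//; apply: h => /=; rewrite mem_rcons inE ik orbT.
    by have := h k; rewrite /= /B2 eqxx; apply; rewrite mem_rcons inE eqxx.
  have prodE : (\prod_(i <- iota 0 k) P (e i @^-1` B2 i) = \prod_(i <- iota 0 k) P (e i
    @^-1` B' i))%E.
    by apply: eq_big_seq => i ik; rewrite B2E.
  have B2k : B2 k = B by rewrite /B2 eqxx.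
  rewrite box_prob// iotaE -cats1 big_cat big_seq1/= prodE B2k.
  rewrite /m2 /= /mscale /= fineK ?fin_num_measure// box_prob//.
  by rewrite muleA muleC.
- move=> _; rewrite /m1 /= /mrestr setTI.
  by apply: le_lt_trans (probability_le1 _ _) _ => //; rewrite ltry.
Qed.

End history.

(** * Integrating out the innovations *)

Section chain_lemmas.
Context {R : realType} (X : completeMetricType R) (sepX : separable X).

(** The distance is Lipschitz in the pair of its arguments; separability is what
    makes it measurable for the product of the Borel sigma-algebras. *)
Lemma measurable_mdist2 d (U : measurableType d) (h1 h2 : U -> borel X) :
  measurable_fun setT h1 -> measurable_fun setT h2 ->
  measurable_fun setT (fun u => mdist (h1 u : X) (h2 u) : R).
Proof.
move=> mh1 mh2.
pose g (z : seqspace (borel X)) : R := mdist (z 0%N : X) (z 1%N).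
have mg : measurable_fun setT g.
  apply: (@lipschitz_measurable _ X sepX g 1 2) => // z z'.
  rewrite mul1r !big_ord_recl big_ord0 addr0 /= /g.
  have h (a b c e : X) : mdist a b - mdist c e <= mdist a c + mdist b e.
    have := metric_triangle a c b; have := metric_triangle c e b.
    by rewrite (metric_sym e b); lra.
  rewrite ler_norml; apply/andP; split; last exact: h.
  have := h (z' 0%N) (z' 1%N) (z 0%N) (z 1%N).
  by rewrite (metric_sym (z' 0%N) (z 0%N)) (metric_sym (z' 1%N) (z 1%N)); rewrite /bump /=; lra.
pose v u : seqspace (borel X) := fun i => if i == 0%N then h1 u else h2 u.
have mv : measurable_fun setT v.
  by apply: measurable_into_seqspace => i; rewrite /v; case: (i == 0%N).
exact: (measurableT_comp mg mv).
Qed.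

Lemma K_succ j (rho : R) : K j.+1 rho = 1 + rho * K j rho.
Proof.
rewrite /K big_nat_recl//= expr0; congr (_ + _).
by rewrite mulr_sumr; apply: eq_bigr => i _; rewrite exprS.
Qed.

Lemma K_ge1 j (rho : R) : 0 <= rho -> 1 <= K j rho.
Proof.
move=> r0; rewrite /K big_nat_recl//= expr0 lerDl.
by apply: sumr_ge0 => i _; rewrite exprn_ge0.
Qed.

End chain_lemmas.

Section chain_mgf.
Context {R : realType} (X Y : completeMetricType R) (sepX : separable X).
Context {d : measure_display} {Omega : measurableType d}.
Variable P : probability Omega R.
Variables (mu : probability (borel X) R) (nu : probability (borel Y) R).
Variables (F : borel X * borel Y -> borel X) (rho : R).
Variables (e : nat -> Omega -> borel Y) (x : nat -> Omega -> borel X).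
Hypotheses (mF : measurable_fun setT F) (rho_ge0 : 0 <= rho).
Hypothesis F_contr : forall a b : X,
  (\int[nu]_y (mdist (F (a, y) : X) (F (b, y)))%:E <= (rho * mdist a b)%:E)%E.
Hypotheses (mx0 : measurable_fun setT (x 0%N)) (me : forall i, measurable_fun setT (e i)).
Hypothesis x0_indep : independent P (x 0%N) (rseq e).
Hypothesis e_indep : mutually_independent P setT e.
Hypothesis x0_law : forall B, measurable B -> P (x 0%N @^-1` B) = mu B.
Hypothesis e_law : forall i B, measurable B -> P (e i @^-1` B) = nu B.
Hypothesis xE : forall i w, x i.+1 w = F (x i w, e i w).
Variable M : nat -> R.

(** The effect on the chain at time i of resampling its i-th source of randomness,
    stated with the laws mu and nu in order to apply [hoeffding_ell] to them. *)
Definition osc_le (i : nat) : Prop := if i is k.+1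
  then {ae P, forall w, {ae nu, forall y', {ae nu, forall y,
    mdist (F (x k w, y) : X) (F (x k w, y')) <= M i}}}
  else {ae mu, forall a' : borel X, {ae mu, forall a : borel X, mdist (a : X) a' <= M 0%N}}.

Definition traj (w : Omega) : seqspace (borel X) := fun i => x i w.

(** The trajectory frozen after time n: it depends only on the first innovations,
    and agrees with [traj] on the coordinates that matter. *)
Definition past (n : nat) (w : Omega) : seqspace (borel X) := fun i => x (minn i n) w.

Lemma measurable_x i : measurable_fun setT (x i).
Proof.
elim: i => [//|i IH]; rewrite (_ : x i.+1 = F \o (fun w => (x i w, e i w))).
  by apply: measurableT_comp => //; exact: measurable_fun_pair.
by apply/funext => w; rewrite xE.
Qed.

Lemma measurable_past n : measurable_fun setT (past n).
Proof. by apply: measurable_into_seqspace => i; exact: measurable_x. Qed.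

Lemma past_indep n : independent P (past n) (e n).
Proof.
pose GT : measurableType _ := g_sigma_algebraType (boxes (x 0%N) e n).
have mX i : (i <= n)%N -> measurable_fun (setT : set GT) (x i : GT -> borel X).
  elim: i => [_|i IH ilen].
    move=> _ A mA; rewrite setTI; apply: sub_gen_smallest.
    exists A, (fun=> setT); split => //.
    by rewrite (_ : \bigcap_(_ in _) _ = setT) ?setIT// -subTset => w _ i _.
  rewrite (_ : x i.+1 = F \o (fun w => (x i w, e i w))); last first.
    by apply/funext => w; rewrite xE.
  have mei : measurable_fun (setT : set GT) (e i : GT -> borel Y).
    move=> _ A mA; rewrite setTI; apply: sub_gen_smallest.
    exists setT, (fun j => if j == i then A else setT); split => //.
      by move=> j; case: ifP.
    rewrite preimage_setT setTI; apply/seteqP; split=> [w wA j _|w].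
      by rewrite /preimage/=; case: eqP => // ->.
    by move=> /(_ i); rewrite /= mem_iota add0n ilen eqxx => /(_ isT).
  apply: (measurableT_comp mF); apply: measurable_fun_pair => //.
  exact: IH (ltnW ilen).
have mpast : measurable_fun (setT : set GT) (past n : GT -> seqspace (borel X)).
  by apply: measurable_into_seqspace => i; apply: mX; exact: geq_minr.
move=> A B mA mB; apply: (history_indep mx0) => //.
by have := mpast measurableT A mA; rewrite setTI.
Qed.

(** Only the weight of the last coordinate changes when an innovation is integrated
    out, from K_j to K_(j+1), which is why j is the only parameter of the weights. *)
Definition last_lip (n j : nat) (f : seqspace (borel X) -> R) : Prop :=
  forall z z' : nat -> X, `|f z - f z'| <=
    \sum_(i < n) mdist (z i) (z' i) + K j rho * mdist (z n) (z' n).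

Lemma last_lip_measurable n j f : last_lip n j f -> measurable_fun setT f.
Proof.
move=> fL; have K1 := K_ge1 j rho_ge0.
apply: (@lipschitz_measurable _ X sepX f (K j rho) n.+1); first by lra.
move=> z z'; apply: le_trans (fL z z') _.
rewrite big_ord_recr/= mulrDr lerD2r ler_peMl//.
by apply: sumr_ge0 => i _; exact: mdist_ge0.
Qed.

Lemma last_lip_ext n j f (z z' : nat -> X) : last_lip n j f ->
  (forall i, (i <= n)%N -> z i = z' i) -> f z = f z'.
Proof.
move=> fL zz'; apply/eqP; rewrite -subr_eq0 -normr_le0.
apply: le_trans (fL z z') _; rewrite zz'// mdistxx mulr0 addr0 big1// => i _.
by rewrite zz' ?mdistxx// ltnW.
Qed.

Definition extend (n : nat) (z : seqspace (borel X)) (a : borel X) : seqspace (borel X) :=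
  fun i => if i == n.+1 then a else z i.

Lemma last_lip_extend n j f (z z' : seqspace (borel X)) (a a' : X) : last_lip n.+1 j f ->
  `|f (extend n z a) - f (extend n z' a')| <=
    \sum_(i < n.+1) mdist (z i : X) (z' i) + K j rho * mdist a a'.
Proof.
move=> fL; apply: le_trans (fL _ _) _; rewrite /extend eqxx lerD2r.
apply: ler_sum => i _; rewrite ifN ?ifN// neq_ltn ltn_ord//.
Qed.

Lemma measurable_extendF n f : measurable_fun setT f ->
  measurable_fun setT (fun zy : seqspace (borel X) * borel Y =>
    f (extend n zy.1 (F (zy.1 n, zy.2))) : R).
Proof.
move=> mf; apply: (measurableT_comp mf).
apply: measurable_into_seqspace => i; rewrite /extend.
have mz k : measurable_fun setT (fun zy : seqspace (borel X) * borel Y => zy.1 k).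
  exact: (measurableT_comp (@measurable_coord _ (borel X) k) (@measurable_fst _ _ _ _)).
case: (i == n.+1) => //.
by apply: (measurableT_comp mF); exact: measurable_fun_pair.
Qed.

Lemma measurable_F_section (a : borel X) : measurable_fun setT (fun y => F (a, y)).
Proof.
exact: (measurableT_comp mF (measurable_fun_pair (measurable_cst _) (@measurable_id _ _ _))).
Qed.

Lemma integrable_mdistF (a b : X) :
  nu.-integrable setT (fun y => (mdist (F (a, y) : X) (F (b, y)))%:E).
Proof.
apply/integrableP; split.
  by apply/measurable_EFinP/(measurable_mdist2 sepX); exact: measurable_F_section.
apply: le_lt_trans (ltry (rho * mdist a b)).
by under eq_integral do rewrite gee0_abs ?lee_fin ?mdist_ge0//.
Qed.

Local Notation cont n f z := (fun y => f (extend n z (F (z n, y)))).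

Lemma measurable_cont n f z : measurable_fun setT f ->
  measurable_fun setT (cont n f z : borel Y -> R).
Proof.
move=> /(measurable_extendF n) h.
exact: (measurableT_comp h (measurable_fun_pair (measurable_cst z) (@measurable_id _ _ _))).
Qed.

(** One step of the decomposition: given the past z, changing the innovation moves
    the last coordinate by at most M and the function by at most K_j M. *)
Lemma cont_mgf n j f z : last_lip n.+1 j f -> 0 < M n.+1 ->
  {ae nu, forall y', {ae nu, forall y, mdist (F (z n, y) : X) (F (z n, y')) <= M n.+1}} ->
  nu.-integrable setT (EFin \o cont n f z) /\
  forall t, (\int[nu]_y (expR (t * cont n f z y))%:E <=
    (expR (t * fine (\int[nu]_y (cont n f z y)%:E) + ell `|K j rho * M n.+1 * t|))%:E)%E.
Proof.
move=> fL M0 hz; have K1 := K_ge1 j rho_ge0.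
apply: hoeffding_ell.
- exact: (measurable_cont _ _ (last_lip_measurable fL)).
- by rewrite mulr_gt0//; lra.
- apply: filterS hz => y'; apply: filterS => y hy.
  apply: le_trans (last_lip_extend _ _ _ _ fL) _.
  rewrite big1 ?add0r => [|i _]; last exact: mdistxx.
  by rewrite ler_wpM2l//; lra.
Qed.

(** Integrability holds at one point, where the oscillation is bounded, and spreads to
    every z because F is Lipschitz in mean. *)
Lemma cont_integrable n j f z : last_lip n.+1 j f -> 0 < M n.+1 -> osc_le n.+1 ->
  nu.-integrable setT (EFin \o cont n f z).
Proof.
move=> fL M0 /ae_exists[w hw].
pose z' : seqspace (borel X) := fun=> x n w.
have [ig _] := @cont_mgf n j f z' fL M0 hw.
pose B : R := \sum_(i < n.+1) mdist (z i : X) (z' i).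
pose g y : R := `|cont n f z' y|.
pose D y : R := mdist (F (z n, y) : X) (F (z' n, y)).
pose h y : R := g y + B + K j rho * D y.
have ih : nu.-integrable setT (EFin \o h).
  rewrite (_ : EFin \o h = (fun y => (EFin \o g) y + (EFin \o (fun=> B)) y +
     (K j rho)%:E * (D y)%:E)%E)//.
  apply: integrableD => //; last by apply: integrableZl => //; exact: integrable_mdistF.
  apply: integrableD => //; last exact: finite_measure_integrable_cst.
  exact: integrable_norm.
apply: le_integrable ih => //.
  apply/measurable_EFinP; exact: (measurable_cont _ _ (last_lip_measurable fL)).
move=> y _; rewrite /= lee_fin.
have := @last_lip_extend n j f z z' (F (z n, y)) (F (z' n, y)) fL.
rewrite -/B => hl; apply: le_trans (ler_norm _); rewrite /h /g /D.
have := ler_normD (cont n f z y - cont n f z' y) (cont n f z' y).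
by rewrite subrK; lra.
Qed.

(** The discrepancy of the integrated coordinate contributes K_j * rho times the
    distance of the n-th coordinates, on top of their own weight 1. *)
Lemma last_lip_mean n j f : last_lip n.+1 j f -> 0 < M n.+1 -> osc_le n.+1 ->
  last_lip n j.+1 (fun z => fine (\int[nu]_y (cont n f z y)%:E)%E).
Proof.
move=> fL M0 hosc z z'.
have iz := cont_integrable z fL M0 hosc; have iz' := cont_integrable z' fL M0 hosc.
have K1 := K_ge1 j rho_ge0.
pose B : R := \sum_(i < n.+1) mdist (z i) (z' i).
have iD := integrable_mdistF (z n) (z' n).
have aff := integral_affine (nu := nu) (g := fun y => mdist (F (z n, y) : X) (F (z' n,
  y))) B (K j rho) iD.
have hD : fine (\int[nu]_y (mdist (F (z n, y) : X) (F (z' n, y)))%:E)%E <= rho * mdist (z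
  n) (z' n).
  by rewrite -lee_fin fineK ?F_contr// (integrable_fin_num measurableT iD).
rewrite -fineB ?(integrable_fin_num measurableT iz) ?(integrable_fin_num measurableT iz')//.
rewrite -integralB//.
have -> : \sum_(i < n) mdist (z i) (z' i) + K j.+1 rho * mdist (z n) (z' n) =
    B + K j rho * (rho * mdist (z n) (z' n)).
  by rewrite K_succ /B big_ord_recr/=; ring.
apply: (@le_trans _ _ (B + K j rho * fine (\int[nu]_y (mdist (F (z n, y) : X) (F (z' n,
  y)))%:E)%E)); last first.
  by rewrite lerD2l ler_wpM2l//; lra.
pose D y : R := mdist (F (z n, y) : X) (F (z' n, y)).
pose h y : R := cont n f z y - cont n f z' y.
have ih : nu.-integrable setT (EFin \o h).
  rewrite (_ : EFin \o h = (fun y => (EFin \o cont n f z) y - (EFin \o cont n f z') y)%E)//.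
  exact: integrableB.
apply: (le_trans (le_normr_Rintegral measurableT ih)).
have <- : fine (\int[nu]_y (B + K j rho * D y)%:E)%E = B + K j rho * fine (\int[nu]_y (D
  y)%:E)%E by rewrite aff.
apply: mean_le.
- exact: integrable_norm.
- exact: integrable_affine.
- by move=> y; exact: (last_lip_extend z z' (F (z n, y)) (F (z' n, y)) fL).
Qed.

(** Induction on the number of coordinates, for all real t with the same m: the two
    signs of t are needed to identify m with the mean afterwards. *)
Theorem chain_mgf n j f : last_lip n j f ->
  (forall i, (i <= n)%N -> 0 < M i) -> (forall i, (i <= n)%N -> osc_le i) ->
  exists m, forall t, (\int[P]_w (expR (t * f (traj w)))%:E <=
    (expR (t * m + \sum_(i < n.+1) ell `|K (n - i + j) rho * M i * t|))%:E)%E.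
Proof.
elim: n j f => [|n IH] j f fL M0 hosc.
  pose g (a : borel X) : R := f (fun=> a).
  have mf := last_lip_measurable fL.
  have mg : measurable_fun setT g.
    by apply: (measurableT_comp mf); apply: measurable_into_seqspace => i; exact: measurable_id.
  have K1 := K_ge1 j rho_ge0.
  have [] := @hoeffding_ell _ _ _ mu g (K j rho * M 0%N) mg.
  - by rewrite mulr_gt0 ?M0//; lra.
  - have h0 : {ae mu, forall a' : borel X, {ae mu, forall a : borel X, mdist (a : X) a'
      <= M 0%N}} := hosc 0%N isT.
    apply: filterS h0 => a'; apply: filterS => a ha.
    apply: le_trans (fL _ _) _; rewrite big_ord0 add0r ler_wpM2l//; lra.
  move=> ig hg; exists (fine (\int[mu]_a (g a)%:E)%E) => t.
  rewrite big_ord_recl big_ord0 addr0 /= subn0 add0n.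
  apply: le_trans (hg t); rewrite (integral_law mx0 x0_law)//; last first.
    by apply/measurable_EFinP; apply: measurableT_comp => //; exact: measurable_funM.
  rewrite le_eqVlt; apply/orP; left; apply/eqP; apply: eq_integral => w _.
  by rewrite /g (@last_lip_ext 0 j f (traj w) (fun=> x 0%N w) fL)// => i; rewrite leqn0
    => /eqP ->.
have Mn := M0 n.+1 (leqnn _); have on := hosc n.+1 (leqnn _).
pose ft z := fine (\int[nu]_y (cont n f z y)%:E)%E.
have ftL : last_lip n j.+1 ft := last_lip_mean fL Mn on.
have [||m hm] := IH j.+1 ft ftL.
- by move=> i ilen; apply: M0; rewrite leqW.
- by move=> i ilen; apply: hosc; rewrite leqW.
exists m => t.
have mft := last_lip_measurable ftL; have mf := last_lip_measurable fL.
have mpast := measurable_past n.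
pose phi (zy : seqspace (borel X) * borel Y) : \bar R :=
  (expR (t * f (extend n zy.1 (F (zy.1 n, zy.2)))))%:E.
have mphi : measurable_fun setT phi.
  apply/measurable_EFinP; apply: measurableT_comp => //; apply: measurable_funM => //.
  exact: measurable_extendF.
have phi0 z : (0 <= phi z)%E by rewrite lee_fin expR_ge0.
pose L := ell `|K j rho * M n.+1 * t|.
have -> : (\int[P]_w (expR (t * f (traj w)))%:E = \int[P]_w phi (past n w, e n w))%E.
  apply: eq_integral => w _; rewrite /phi /=; congr (expR (t * _))%:E.
  apply: (last_lip_ext fL) => i; rewrite leq_eqVlt /extend /past /traj => /predU1P[->|].
    by rewrite eqxx minnn xE.
  by rewrite ltnS => ilen; rewrite ltn_eqF ?ltnS// (minn_idPl ilen).
rewrite (indep_fubini mpast (me n) (@e_law n) (past_indep n) mphi phi0).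
apply: (@le_trans _ _ (\int[P]_w (expR (t * ft (past n w) + L))%:E)%E).
  apply: ae_ge0_le_integral => //.
  - by move=> w _; exact: integral_ge0.
  - exact: (measurableT_comp (measurable_fun_fubini_tonelli_F (m2 := nu) phi mphi phi0) mpast).
  - apply/measurable_EFinP; apply: measurableT_comp => //; apply: measurable_funD => //.
    by apply: measurable_funM => //; exact: measurableT_comp.
  - have {}on : {ae P, forall w, {ae nu, forall y', {ae nu, forall y,
        mdist (F (x n w, y) : X) (F (x n w, y')) <= M n.+1}}} := on.
    apply: filterS on => w hw _.
    have hw' : {ae nu, forall y', {ae nu, forall y,
        mdist (F (past n w n, y) : X) (F (past n w n, y')) <= M n.+1}}.
      by rewrite /past minnn.
    exact: (cont_mgf fL Mn hw').2.
have -> : (\int[P]_w (expR (t * ft (past n w) + L))%:E =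
    (expR L)%:E * \int[P]_w (expR (t * ft (traj w)))%:E)%E.
  rewrite -ge0_integralZl//.
  - apply: eq_integral => w _; rewrite -EFinM addrC expRD; congr (_ * expR (t * _))%:E.
    by apply: (last_lip_ext ftL) => i ilen; rewrite /past /traj (minn_idPl ilen).
  - apply/measurable_EFinP; apply: measurableT_comp => //; apply: measurable_funM => //.
    apply: (measurableT_comp mft); apply: measurable_into_seqspace => i; exact: measurable_x.
apply: (@le_trans _ _ ((expR L)%:E * (expR (t * m + \sum_(i < n.+1) ell `|K (n - i +
  j.+1) rho * M i * t|))%:E)%E).
  by apply: lee_wpmul2l; [rewrite lee_fin expR_ge0|exact: hm].
rewrite -EFinM -expRD lee_fin ler_expR [in leRHS]big_ord_recr/= subnn add0n -/L.
rewrite [leLHS]addrC -addrA lerD2l lerD2r; apply: ler_sum => i _.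
by rewrite subSn ?(ltnW (ltn_ord i))// -1?ltnS// addSnnS.
Qed.

End chain_mgf.

(** * From Laplace transforms to means and tails *)

Section mgf_to_tail.
Context {R : realType} {d : measure_display} {Omega : measurableType d}.
Variable P : probability Omega R.

Lemma expR_sub1_le (s : R) : 0 <= s -> s <= 1 / 2 -> expR s - 1 <= 2 * s.
Proof.
move=> s0 s2; have := expR_ge1Dx (- s); rewrite expRN => h.
have e0 := expR_gt0 s.
have : expR s * (1 - s) <= 1 by have := ler_wpM2l (ltW e0) h; rewrite divff ?gt_eqF.
nra.
Qed.

(** Integrating 1 + t (g - m) <= exp (t (g - m)) gives 1 + t a <= exp (C t^2) for
    the mean a of g - m and all small t of both signs, hence a = 0. *)
Lemma mgf_mean (g : Omega -> R) (m C delta : R) :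
  measurable_fun setT g -> 0 < C -> 0 < delta ->
  (forall t, `|t| <= delta ->
    (\int[P]_w (expR (t * g w))%:E <= (expR (t * m + C * t ^+ 2))%:E)%E) ->
  (\int[P]_w (g w)%:E = m%:E)%E.
Proof.
move=> mg C0 delta0 hmgf.
pose u w := g w - m.
have mu_ : measurable_fun setT u by exact: measurable_funB.
have mexp t : measurable_fun setT (fun w => expR (t * u w)).
  by apply: measurableT_comp => //; exact: measurable_funM.
have hu t : `|t| <= delta -> (\int[P]_w (expR (t * u w))%:E <= (expR (C * t ^+ 2))%:E)%E.
  move=> td.
  have -> : (\int[P]_w (expR (t * u w))%:E = (expR (- (t * m)))%:E * \int[P]_w (expR (t *
    g w))%:E)%E.
    rewrite -ge0_integralZl//; last first.
      by apply/measurable_EFinP; apply: measurableT_comp => //; exact: measurable_funM.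
    by apply: eq_integral => w _; rewrite -EFinM -expRD; congr (expR _)%:E; rewrite /u; ring.
  apply: le_trans (lee_wpmul2l _ (hmgf t td)) _; first by rewrite lee_fin expR_ge0.
  by rewrite -EFinM -expRD lee_fin ler_expR; lra.
have iexp t : `|t| <= delta -> P.-integrable setT (EFin \o (fun w => expR (t * u w))).
  move=> td; apply/integrableP; split; first exact/measurable_EFinP.
  apply: le_lt_trans (ltry (expR (C * t ^+ 2))).
  apply: le_trans (hu t td); under eq_integral do rewrite gee0_abs ?lee_fin ?expR_ge0//=.
  by [].
have dd : `|delta| <= delta by rewrite gtr0_norm.
have ndd : `|- delta| <= delta by rewrite normrN.
have iu : P.-integrable setT (EFin \o u).
  pose h w := delta^-1 * (expR (delta * u w) + expR (- delta * u w)).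
  have ih : P.-integrable setT (EFin \o h).
    rewrite (_ : EFin \o h = (fun w => (delta^-1)%:E *
      ((EFin \o (fun w => expR (delta * u w))) w + (EFin \o (fun w => expR (- delta * u
        w))) w))%E)//.
    by apply: integrableZl => //; apply: integrableD => //; exact: iexp.
  apply: le_integrable ih => //; first exact/measurable_EFinP.
  move=> w _; rewrite /= lee_fin; apply: le_trans (ler_norm _).
  rewrite /h -(@ler_pM2l _ delta)// mulVKf ?gt_eqF//.
  have e1 := expR_ge1Dx (delta * u w); have e2 := expR_ge1Dx (- delta * u w).
  have e3 := expR_gt0 (delta * u w); have e4 := expR_gt0 (- delta * u w).
  by have [?|?] := ler0P (u w); lra.
pose a := fine (\int[P]_w (u w)%:E)%E.
have key t : `|t| <= delta -> 1 + t * a <= expR (C * t ^+ 2).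
  move=> td; rewrite -lee_fin -integral_affine//; apply: le_trans (hu t td).
  apply: le_integral => //.
  - exact: integrable_affine.
  - exact: iexp.
  - by move=> w _; rewrite lee_fin expR_ge1Dx.
have a0 : a = 0.
  apply/eqP; rewrite -normr_eq0; apply/negPn/negP => an0.
  have {an0} a0 : 0 < `|a| by rewrite lt_neqAle eq_sym an0 normr_ge0.
  (* Small enough for the linear term t |a| to beat 2 C t^2. *)
  pose t := Num.min delta (Num.min (Num.min 1 (1 / (2 * C))) (`|a| / (4 * C))).
  have t0 : 0 < t by rewrite !lt_min delta0 ltr01 !divr_gt0 ?mulr_gt0.
  have td : t <= delta by rewrite /t ge_min lexx.
  have t1 : t <= 1 by rewrite /t !ge_min lexx !orbT.
  have tC : t * (2 * C) <= 1.
    by rewrite -ler_pdivlMr ?mulr_gt0// /t !ge_min lexx !orbT.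
  have ta : t * (4 * C) <= `|a| by rewrite -ler_pdivlMr ?mulr_gt0// /t !ge_min lexx !orbT.
  have h : t * `|a| <= expR (C * t ^+ 2) - 1.
    have := @key t; have := @key (- t); rewrite normrN (gtr0_norm t0) sqrrN => /(_ td) k1
      /(_ td) k2.
    by have [?|?] := ler0P a; lra.
  have := @expR_sub1_le (C * t ^+ 2).
  have s0 : 0 <= C * t ^+ 2 by rewrite mulr_ge0 ?sqr_ge0// ltW.
  have s1 : C * t ^+ 2 <= 1 / 2 by nra.
  move=> /(_ s0 s1) h2.
  have : t * `|a| <= t * (2 * C * t) by nra.
  by rewrite ler_pM2l//; lra.
have : (\int[P]_w (m + 1 * u w)%:E = (m + 1 * a)%:E)%E by exact: integral_affine.
rewrite a0 mulr0 addr0 => <-.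
by apply: eq_integral => w _; rewrite /u mul1r addrC subrK.
Qed.

(** The exponential Markov inequality at t = u D / M2 gives the exponent
    -(D^2 / M2) (u x / D - ell u); then take the supremum over u. *)
Lemma chernoff_ell (g : Omega -> R) (D M2 : R) (x : R) : measurable_fun setT g ->
  0 < D -> 0 < M2 ->
  (forall t, 0 <= t -> (\int[P]_w (expR (t * g w))%:E <=
    (expR (D ^+ 2 / M2 * ell (M2 * t / D)))%:E)%E) ->
  (P [set w | (x < g w)%R] <= expeR (- ((D ^+ 2 / M2)%:E * ellstar (x / D))))%E.
Proof.
move=> mg D0 M20 hmgf.
pose A := [set w | x < g w].
have mA : measurable A.
  have := mg measurableT _ (measurable_itv `]x, +oo[); rewrite setTI.
  by congr (measurable _); apply/seteqP; split => w /=; rewrite in_itv /= andbT.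
have q0 : 0 < D ^+ 2 / M2 by rewrite divr_gt0// exprn_gt0.
have Pfin : P A \is a fin_num by exact: fin_num_measure.
pose p := fine (P A); have pE : P A = p%:E by rewrite fineK.
have p0 : 0 <= p by rewrite fine_ge0.
have key u : 0 < u -> p <= expR (- (D ^+ 2 / M2 * (x / D * u - ell u))).
  move=> u0; pose t := u * D / M2.
  have t0 : 0 < t by rewrite divr_gt0// mulr_gt0.
  have ht := hmgf t (ltW t0).
  have uE : M2 * t / D = u by rewrite /t; field; rewrite !gt_eqF.
  rewrite uE in ht.
  have : (P A <= (expR (- (t * x)))%:E * \int[P]_w (expR (t * g w))%:E)%E.
    rewrite -ge0_integralZl//; last first.
      by apply/measurable_EFinP; apply: measurableT_comp => //; exact: measurable_funM.
    have -> : P A = (\int[P]_w (\1_A w)%:E)%E by rewrite integral_indic// setIT.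
    apply: ge0_le_integral => //.
    - by apply/measurable_EFinP; exact: measurable_indic.
    - apply/measurable_EFinP; apply: measurable_funM => //.
      by apply: measurableT_comp => //; exact: measurable_funM.
    - move=> w _; rewrite -EFinM lee_fin -expRD indicE.
      case: (boolP (w \in A)) => [|_]; last exact: expR_ge0.
      rewrite inE /A /= => xg; rewrite -[leLHS]expR0 ler_expR.
      have : t * x <= t * g w by rewrite ler_pM2l// ltW.
      lra.
  move=> h; have {}h := le_trans h (lee_wpmul2l _ ht).
  have {h} : (P A <= (expR (- (t * x)))%:E * (expR (D ^+ 2 / M2 * ell u))%:E)%E.
    by apply: h; rewrite lee_fin expR_ge0.
  rewrite pE -EFinM -expRD lee_fin => /le_trans; apply; rewrite le_eqVlt; apply/orP; left.
  by apply/eqP; congr expR; rewrite /t; field; rewrite !gt_eqF.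
rewrite pE; move: p0; rewrite le_eqVlt => /predU1P[<-|p0]; first exact: expeR_ge0.
have hstar : (ellstar (x / D) <= (- ln p / (D ^+ 2 / M2))%:E)%E.
  apply: ub_ereal_sup => _ [u /= u0 <-]; rewrite lee_fin ler_pdivlMr//.
  have := key u u0; rewrite -{1}(lnK (x := p)) ?posrE// ler_expR; lra.
rewrite -{1}(lnK (x := p)) ?posrE//.
have -> : (expR (ln p))%:E = expeR (ln p)%:E by [].
rewrite lee_expeR leeNr.
apply: le_trans (lee_wpmul2l _ hstar) _; first by rewrite lee_fin ltW.
by rewrite -EFinM -EFinN lee_fin mulrC divfK ?gt_eqF.
Qed.

End mgf_to_tail.

(** * The deviation inequalities *)

Theorem proposition3p6 (R : realType)
  (X Y : completeMetricType R) (sepX : separable X) (sepY : separable Y)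
  (d : measure_display) (Omega : measurableType d) (P : probability Omega R)
  (* eps k is used for k >= 1, chain k for k >= 1, eps' k for k >= 2 *)
  (eps eps' : nat -> {RV P >-> borel Y})
  (chain : nat -> {RV P >-> borel X}) (X1' : {RV P >-> borel X})
  (F : borel X * borel Y -> borel X) (rho : R)
  (eps_iid : iid P [set i | (1 <= i)%N] eps)
  (X1_indep : independent P (chain 1%N) (rseq (fun i => eps i.+2)))
  (F_meas : measurable_fun setT F)
  (chainE : forall k, (2 <= k)%N ->
    forall w, chain k w = F (chain k.-1 w, eps k w))
  (rho_ge0 : 0 <= rho) (rho_lt1 : rho < 1)
  (F_contr : forall x x' : X,
    ('E_P[fun w => mdist (F (x, eps 1%N w) : X) (F (x', eps 1%N w))]
       <= (rho * mdist x x')%:E)%E)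
  (copy_indep : independent P
    (rpair (chain 1%N) (rseq (fun i => eps i.+2)))
    (rpair X1' (rseq (fun i => eps' i.+2))))
  (copy_law : same_law P
    (rpair (chain 1%N) (rseq (fun i => eps i.+2)))
    (rpair X1' (rseq (fun i => eps' i.+2))))
  (n : nat) (n_ge1 : (1 <= n)%N) (f : n.-tuple X -> R)
  (f_lip : forall x x' : n.-tuple X,
    `|f x - f x'| <= \sum_(i < n) mdist (tnth x i) (tnth x' i))
  (M : nat -> R) (M_gt0 : forall k, (1 <= k <= n)%N -> 0 < M k)
  (M1_bound :
    (Lnorm P +oo (fun w => (mdist (chain 1%N w : X) (X1' w))%:E) <= (M 1%N)%:E)%E)
  (Mk_bound : forall k, (2 <= k <= n)%N ->
    (Lnorm P +oo (fun w => (mdist (F (chain k.-1 w, eps k w) : X)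
                               (F (chain k.-1 w, eps' k w)))%:E)
       <= (M k)%:E)%E) :
  let S := centered P (fun w => f [tuple chain i.+1 w : X | i < n]) in
  let M2 := Msq M n rho in
  let D := Dsum M n rho in
  forall b : bool,
  [/\ forall t : R, 0 <= t ->
        ('E_P[fun w => expR ((-1) ^+ b * t * S w)]
           <= (expR (D ^+ 2 / M2 * ell (M2 * t / D)))%:E)%E,
      forall x : R, 0 <= x <= D ->
        (P [set w | (x < (-1) ^+ b * S w)%R]
           <= expeR (- ((D ^+ 2 / M2)%:E * ellstar (x / D))))%E
    & forall x : R, 0 <= x <= D ->
        (P [set w | (x < (-1) ^+ b * S w)%R]
           <= (((D - x) / D) `^ ((2 * D * x - x ^+ 2) / M2))%:E)%E].

Proof.
case: n n_ge1 f f_lip M_gt0 Mk_bound => [//|n] _ f f_lip M_gt0 Mk_bound S M2 D b.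
pose e i : Omega -> borel Y := eps i.+2.
pose x i : Omega -> borel X := chain i.+1.
pose nu : probability (borel Y) R := distribution P (eps 1%N).
pose mu : probability (borel X) R := distribution P (chain 1%N).
have me i : measurable_fun setT (e i) by exact: measurable_funP.
have mx i : measurable_fun setT (x i) by exact: measurable_funP.
have e_law i B : measurable B -> P (e i @^-1` B) = nu B by move=> mB; exact: eps_iid.2.
have xE i w : x i.+1 w = F (x i w, e i w) by exact: chainE.
have contr (p q : X) : (\int[nu]_y (mdist (F (p, y) : X) (F (q, y)))%:E <= (rho * mdist p
  q)%:E)%E.
  have := F_contr p q; rewrite unlock => /(le_trans _); apply.
  rewrite ge0_integral_distribution//.
    by apply/measurable_EFinP/(measurable_mdist2 sepX); exact: measurable_F_section.
  by move=> y; rewrite lee_fin mdist_ge0.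
have e_indep : mutually_independent P setT e.
  move=> s B us _ mB; pose B' k := B k.-2.
  have /(_ (map (fun i => i.+2) s) B') := eps_iid.1.
  rewrite map_inj_uniq => [/(_ us)|i j [->//]].
  have sD : [set` [seq i.+2 | i <- s]] `<=` [set i | (1 <= i)%N].
    by move=> k /= /mapP[i _ ->].
  move=> /(_ sD (fun i => mB _)); rewrite big_map => <-; congr (P _).
  apply/seteqP; split=> w /= h.
    by move=> k /= /mapP[i si ->]; exact: h.
  by move=> i /= si; apply: (h i.+2); apply/mapP; exists i.
(* The chain as a function of X_1 and the innovations: this transports the
   independence and the law of the copies to the variables of each time. *)
pose C := fix C k (z : borel X * seqspace (borel Y)) : borel X :=
  if k is k'.+1 then F (C k' z, z.2 k') else z.1.
have mC k : measurable_fun setT (C k).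
  elim: k => [|k IH]; first exact: measurable_fst.
  apply: (measurableT_comp F_meas); apply: measurable_fun_pair => //.
  exact: (measurableT_comp (@measurable_coord _ (borel Y) k) (@measurable_snd _ _ _ _)).
have xC k w : x k w = C k (chain 1%N w, rseq e w).
  by elim: k => [//|k IH]; rewrite xE IH.
have x0_law B : measurable B -> P (x 0%N @^-1` B) = mu B by [].
have mX1' : measurable_fun setT X1' by exact: measurable_funP.
have me' i : measurable_fun setT (eps' i.+2) by exact: measurable_funP.
have X1'_law B : measurable B -> P (X1' @^-1` B) = mu B.
  move=> mB; have := copy_law (B `*` setT) (measurableX mB measurableT).
  have pre (U : Omega -> borel X) (V : Omega -> seqspace (borel Y)) :
      rpair U V @^-1` (B `*` setT) = U @^-1` B.
    by apply/seteqP; split=> w /=; [case|].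
  by rewrite !pre.
have e'_law k B : measurable B -> P (eps' k.+2 @^-1` B) = nu B.
  move=> mB; rewrite -(e_law k B mB).
  pose A := [set: borel X] `*` ((fun y : seqspace (borel Y) => y k) @^-1` B).
  have mA : measurable A.
    apply: measurableX => //.
    by have := @measurable_coord _ (borel Y) k measurableT B mB; rewrite setTI.
  have := copy_law A mA.
  have pre (U : Omega -> borel X) (V : nat -> Omega -> borel Y) :
      rpair U (rseq V) @^-1` A = V k @^-1` B.
    by apply/seteqP; split=> w /=; [case|].
  by rewrite !pre.
have Linfty (h : Omega -> R) r : (forall w, 0 <= h w) ->
    (Lnorm P +oo (EFin \o h) <= r%:E)%E -> {ae P, forall w, h w <= r}.
  have P0 : (0 < P setT)%E by rewrite probability_setT lte01.
  move=> h0; rewrite unlock ifT// => /ess_supP.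
  by apply: filterS => w /=; rewrite lee_fin ger0_norm.
(* Together with the independence of the copies, the essential bounds on Omega
   become bounds for almost all pairs of values of the resampled variable. *)
have osc0 : osc_le P mu nu F x (fun i => M i.+1) 0.
  pose Q := [set z : borel X * borel X | (mdist (z.1 : X) z.2 : R) <= M 1%N].
  have mQ : measurable Q.
    have := measurable_mdist2 sepX (@measurable_fst _ _ (borel X) (borel X))
      (@measurable_snd _ _ _ _).
    move=> /(_ measurableT _ (measurable_itv `]-oo, M 1%N])); rewrite setTI.
    by congr (measurable _); apply/seteqP; split => w /=; rewrite in_itv.
  have ind : independent P (chain 1%N) X1'.
    exact: (indep_comp (@measurable_fst _ _ _ _) (@measurable_fst _ _ _ _) copy_indep).
  have hQ : {ae P, forall w, Q (chain 1%N w, X1' w)}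
    by exact: (Linfty (fun w => mdist (chain 1%N w : X) (X1' w)) _ (fun w => mdist_ge0 _
      _) M1_bound).
  have h := indep_ae (mx 0%N) mX1' x0_law X1'_law ind mQ hQ.
  apply: filterS h => a'; apply: filterS => a.
  by rewrite /Q /= metric_sym.
have osck k : (k < n)%N -> osc_le P mu nu F x (fun i => M i.+1) k.+1.
  move=> kn.
  pose Q := [set z : borel X * borel Y * borel Y |
    (mdist (F (z.1.1, z.2) : X) (F (z.1.1, z.1.2)) : R) <= M k.+2].
  have mQ : measurable Q.
    have m11 : measurable_fun setT (fun z : borel X * borel Y * borel Y => z.1.1).
      exact: (measurableT_comp (@measurable_fst _ _ _ _) (@measurable_fst _ _ _ _)).
    have m12 : measurable_fun setT (fun z : borel X * borel Y * borel Y => z.1.2).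
      exact: (measurableT_comp (@measurable_snd _ _ _ _) (@measurable_fst _ _ _ _)).
    have m1 := measurableT_comp F_meas (measurable_fun_pair m11 (@measurable_snd _ _ _ _)).
    have m2 := measurableT_comp F_meas (measurable_fun_pair m11 m12).
    have := measurable_mdist2 sepX m1 m2.
    move=> /(_ measurableT _ (measurable_itv `]-oo, M k.+2])); rewrite setTI.
    by congr (measurable _); apply/seteqP; split => w /=; rewrite in_itv.
  have ind1 : independent P (x k) (e k).
    have := past_indep F_meas (mx 0%N) me X1_indep e_indep xE k.
    move=> /(indep_comp (@measurable_coord _ (borel X) k) (@measurable_id _ _ setT)).
    by rewrite (_ : _ \o past x k = x k)//; apply/funext => w; rewrite /past /= minnn.
  have ind2 : independent P (rpair (x k) (e k)) (eps' k.+2).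
    pose g (z : borel X * seqspace (borel Y)) := (C k z, z.2 k).
    have mg : measurable_fun setT g.
      apply: measurable_fun_pair => //.
      exact: (measurableT_comp (@measurable_coord _ (borel Y) k) (@measurable_snd _ _ _ _)).
    have ms : measurable_fun setT (fun z : borel X * seqspace (borel Y) => z.2 k).
      exact: (measurableT_comp (@measurable_coord _ (borel Y) k) (@measurable_snd _ _ _ _)).
    have := indep_comp mg ms copy_indep.
    by rewrite (_ : g \o _ = rpair (x k) (e k))//; apply/funext => w; rewrite /g /rpair /= xC.
  have hQ : {ae P, forall w, Q (x k w, e k w, eps' k.+2 w)}.
    have kn' : (2 <= k.+2 <= n.+1)%N by rewrite /= ltnS.
    have := Linfty (fun w => mdist (F (x k w, e k w) : X) (F (x k w, eps' k.+2 w))) _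
      (fun w => mdist_ge0 _ _) (Mk_bound k.+2 kn').
    by apply: filterS => w; rewrite /Q /= metric_sym.
  exact: (indep_ae2 (mx k) (me k) (me' k) (e_law k) (e'_law k) ind1 ind2 mQ hQ).
pose fhat (z : seqspace (borel X)) : R := f [tuple (z i : X) | i < n.+1].
have fL : last_lip rho n 0 fhat.
  move=> z z'; apply: le_trans (f_lip _ _) _.
  rewrite big_ord_recr/= !tnth_mktuple /K big_nat1 expr0 mul1r lerD2r.
  by apply: ler_sum => i _; rewrite !tnth_mktuple.
pose c (i : 'I_n.+1) : R := K (n - i) rho * M i.+1.
have c0 i : 0 < c i.
  by rewrite mulr_gt0 ?M_gt0 ?ltn_ord//; apply: lt_le_trans (K_ge1 _ rho_ge0).
have DE : D = \sum_i c i by rewrite /D /Dsum big_add1 big_mkord.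
have M2E : M2 = \sum_i c i ^+ 2 by rewrite /M2 /Msq big_add1 big_mkord.
have D0 : 0 < D by rewrite DE big_ord_recl ltr_wpDr// sumr_ge0// => i _; exact/ltW.
have M20 : 0 < M2.
  by rewrite M2E big_ord_recl ltr_wpDr ?exprn_gt0// sumr_ge0// => i _; exact: sqr_ge0.
pose g w : R := f [tuple (chain i.+1 w : X) | i < n.+1].
have [m hm] : exists m, forall t, (\int[P]_w (expR (t * g w))%:E <=
    (expR (t * m + D ^+ 2 / M2 * ell (M2 * `|t| / D)))%:E)%E.
  pose M' i := M i.+1.
  have M'0 i : (i <= n)%N -> 0 < M' i by move=> ilen; exact: M_gt0.
  have osc' i : (i <= n)%N -> osc_le P mu nu F x M' i by case: i => [_|i ilen]; [exact:
    osc0|exact: osck].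
  have [m hm] := chain_mgf sepX F_meas rho_ge0 contr (mx 0%N) me X1_indep e_indep x0_law
    e_law xE fL M'0 osc'.
  exists m => t; apply: le_trans (hm t) _; rewrite lee_fin ler_expR lerD2l.
  have <- : \sum_i ell (c i * `|t|) = \sum_(i < n.+1) ell `|K (n - i + 0) rho * M i.+1 * t|.
    by apply: eq_bigr => i _; rewrite addn0 normrM (gtr0_norm (c0 i)).
  exact: ell_jensen.
have mg : measurable_fun setT g.
  have mtraj : measurable_fun setT (traj x) by exact: measurable_into_seqspace.
  exact: (measurableT_comp (last_lip_measurable sepX rho_ge0 fL) mtraj).
have gm : (\int[P]_w (g w)%:E = m%:E)%E.
  (* On this range of t, ell u <= u^2 / 8 at u = M2 |t| / D, and D^2 / M2 * u^2 = M2 t^2. *)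
  apply: (@mgf_mean _ _ _ P g m (M2 / 8) (3 / 2 * D / M2)) => //.
  - by rewrite divr_gt0.
  - by rewrite divr_gt0// mulr_gt0// divr_gt0.
  - move=> t td; apply: le_trans (hm t) _; rewrite lee_fin ler_expR lerD2l.
    have [->|t0] := eqVneq t 0; first by rewrite normr0 mulr0 mul0r ell0 mulr0 expr0n mulr0.
    have u0 : 0 < M2 * `|t| / D by rewrite divr_gt0// mulr_gt0// normr_gt0.
    have u32 : M2 * `|t| / D <= 3 / 2 by rewrite ler_pdivrMr// mulrC -ler_pdivlMr.
    have q0 : 0 <= D ^+ 2 / M2 by rewrite divr_ge0 ?sqr_ge0// ltW.
    have := ler_wpM2l q0 (ell_le u0 u32) => /le_trans; apply.
    set u := M2 * `|t| / D.
    apply: (@le_trans _ _ (D ^+ 2 / M2 * (u ^+ 2 / 8))).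
      have u4 : 0 <= u ^+ 4 by rewrite exprn_ge0// ltW.
      by apply: ler_wpM2l; [exact: q0|lra].
    rewrite le_eqVlt; apply/orP; left; apply/eqP.
    have -> : t ^+ 2 = `|t| ^+ 2 by rewrite real_normK ?num_real.
    by rewrite /u; field; rewrite !gt_eqF.
have SE w : S w = g w - m by rewrite /S /centered unlock gm.
have mgf t : 0 <= t -> (\int[P]_w (expR (t * ((-1) ^+ b * S w)))%:E <=
    (expR (D ^+ 2 / M2 * ell (M2 * t / D)))%:E)%E.
  (* The bound is even in t, so both signs of S are covered at once. *)
  move=> t0; pose t' := (-1) ^+ b * t.
  have t'E : `|t'| = t by rewrite normrM normrX normrN1 expr1n mul1r ger0_norm.
  have -> : (\int[P]_w (expR (t * ((-1) ^+ b * S w)))%:E =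
      (expR (- (t' * m)))%:E * \int[P]_w (expR (t' * g w))%:E)%E.
    rewrite -ge0_integralZl//; last first.
      by apply/measurable_EFinP; apply: measurableT_comp => //; exact: measurable_funM.
    by apply: eq_integral => w _; rewrite -EFinM -expRD; congr (expR _)%:E; rewrite SE
      /t'; ring.
  apply: le_trans (lee_wpmul2l _ (hm t')) _; first by rewrite lee_fin expR_ge0.
  by rewrite -EFinM -expRD lee_fin ler_expR t'E addrA addNr add0r.
have mS : measurable_fun setT (fun w => (-1) ^+ b * S w).
  rewrite (_ : (fun w => _) = (fun w => (-1) ^+ b * (g w - m))); last first.
    by apply/funext => w; rewrite SE.
  by apply: measurable_funM => //; exact: measurable_funB.
have tail y := chernoff_ell y mS D0 M20 mgf.
split => [t t0|y _|y /andP[y0 yD]].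
- rewrite unlock; apply: le_trans (mgf t t0).
  rewrite le_eqVlt; apply/orP; left; apply/eqP.
  by apply: eq_integral => w _; congr (expR _)%:E; ring.
- exact: tail.
- move: y0; rewrite le_eqVlt => /predU1P[<-|y0].
    rewrite mulr0 expr0n/= !subr0 mul0r powRr0; apply: probability_le1.
    have := mS measurableT _ (measurable_itv `]0, +oo[); rewrite setTI.
    by congr (measurable _); apply/seteqP; split => w /=; rewrite in_itv /= andbT.
  exact: le_trans (tail y) (powR_bound D0 M20 y0 yD).
Qed.
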